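(* Let $(M^4,g)$ be a scalar-flat Riemannian manifold with an asymptotically flat end, identified with the exterior of a ball in $\mathbb R^4$, having asymptotically flat coordinates in which $$g_{ij}=\delta_{ij}+\bigl((\mathrm W_\infty)_{ik\ell j}+\Xi(\lambda)_{ijk\ell}\bigr)\frac{x_kx_\ell}{|x|^4}+\mathcal O_\infty(|x|^{-2-\varepsilon}),\qquad \varepsilon\in(0,1),$$ where $\mathrm W_\infty$ is an algebraic Weyl tensor on $\mathbb R^4$ and $\Xi(\lambda)$ is the constant mass tensor (see context). Assume that $\mathrm W_\infty\neq0$. Then for all sufficiently large $r$, the metric $\sigma_r$ induced by $g$ on the coordinate sphere $\mathbb S_r=\{x\in\mathbb R^4:|x|=r\}$ is not locally isometrically embeddable into the flat Euclidean space $\mathbb R^4$.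
   Context: An algebraic Weyl tensor on $\mathbb R^4$ is a $(0,4)$-tensor with the symmetries of a Riemann curvature tensor (including the first Bianchi identity) and vanishing Ricci contraction. $\mathcal O_\infty(|x|^{-s})$ denotes a term all of whose derivatives satisfy $\partial^\beta(\cdot)=\mathcal O(|x|^{-s-|\beta|})$. Repeated indices are summed. The mass tensor. $\Xi(\lambda)_{ijk\ell}$ is a constant tensor depending only on $\lambda=9\,m_{\mathrm{ADM}}(g)$, whose tangential part on round spheres is $\Xi(\lambda)_{ijk\ell}X^iY^j\omega_k\omega_\ell=-\frac{\lambda}{9}\langle X,Y\rangle$ for every unit vector $\omega$ and all $X,Y\perp\omega$. Thus, with $\hat\sigma_r:=r^{-2}\sigma_r$ viewed on $\mathbb S^3$ via $\omega\mapsto r\omega$ and $\sigma$ the round metric on $\mathbb S^3$, one has $\hat\sigma_r=\sigma+r^{-2}\tau+\mathcal O(r^{-2-\varepsilon})$ with $\tau(X,Y)=-\frac{\lambda}{9}\sigma(X,Y)+\mathrm W_\infty(X,\omega,\omega,Y)$ for $X,Y\in T_\omega\mathbb S^3$. ADM mass. $m_{\mathrm{ADM}}(g):=\frac{1}{6\omega_3}\lim_{r\to\infty}\int_{\{|x|=r\}}(\partial_jg_{ij}-\partial_ig_{jj})(\nu_E)^i\,dS_E$, $\omega_3=2\pi^2$, with $\nu_E,dS_E$ the Euclidean outward unit normal and hypersurface measure. A Riemannian 3-manifold is locally isometrically embeddable into $\mathbb R^4$ if every point has a neighborhood admitting a smooth isometric embedding into $\mathbb R^4$ with its Euclidean metric.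 *)

(* Defs.v *)
From HB Require Import structures.
From mathcomp Require Import all_boot all_order all_algebra.
From mathcomp Require Import all_classical all_reals all_analysis.
Set Implicit Arguments.
Unset Strict Implicit.
Unset Printing Implicit Defensive.
Import Order.TTheory GRing.Theory Num.Theory.
Import numFieldNormedType.Exports.
Local Open Scope classical_set_scope.
Local Open Scope ring_scope.

(* The library norm on row vectors is the sup norm; Euclidean lengths are
   always measured with [enorm]. *)
Notation E4 R := 'rV[R]_4.

Definition dot (R : realType) (x y : E4 R) : R := \sum_i x 0 i * y 0 i.

Definition enorm (R : realType) (x : E4 R) : R := Num.sqrt (dot x x).

(* pd [:: i1; ...; ik] f = d_i1 (... (d_ik f)). *)
Definition pd (R : realType) (V : normedModType R) (s : seq 'I_4)
    (f : E4 R -> V) : E4 R -> V :=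
  foldr (fun i h x => 'D_(delta_mx 0 i) h x) f s.

(* C^oo on U, meant for open U. *)
Definition smooth_on (R : realType) (V : normedModType R) (U : set (E4 R))
    (f : E4 R -> V) : Prop :=
  forall (s : seq 'I_4) x, U x ->
    {for x, continuous (pd s f)} /\
    forall i : 'I_4, derivable (pd s f) x (delta_mx 0 i).

Definition bigO_oo (R : realType) (s : R) (f : E4 R -> R^o) : Prop :=
  forall b : seq 'I_4, exists C r0 : R, forall x, r0 < enorm x ->
    `|pd b f x| <= C * enorm x `^ (- s - (size b)%:R).

Definition metric_field (R : realType) := E4 R -> 'M[R]_4.

Definition inner (R : realType) (g : metric_field R) (x X Y : E4 R) : R :=
  \sum_i \sum_j g x i j * X 0 i * Y 0 j.

Definition riemannian_on (R : realType) (U : set (E4 R)) (g : metric_field R)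
    : Prop :=
  [/\ forall i j, smooth_on U (fun x => g x i j : R^o),
      forall x, U x -> (g x)^T = g x
    & forall x X, U x -> X != 0 -> 0 < inner g x X X].

Definition dmetric (R : realType) (g : metric_field R) (k i j : 'I_4)
    (x : E4 R) : R :=
  pd [:: k] (fun y => g y i j : R^o) x.

(* christoffel g k i j = Gamma^k_ij. *)
Definition christoffel (R : realType) (g : metric_field R) (k i j : 'I_4)
    (x : E4 R) : R :=
  2^-1 * \sum_l invmx (g x) k l *
    (dmetric g i j l x + dmetric g j i l x - dmetric g l i j x).

Definition scalar_curvature (R : realType) (g : metric_field R) (x : E4 R) : R :=
  \sum_j \sum_k invmx (g x) j k * \sum_i
    (pd [:: i] (christoffel g i j k : E4 R -> R^o) x
     - pd [:: j] (christoffel g i i k : E4 R -> R^o) x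
     + \sum_p (christoffel g i i p x * christoffel g p j k x
               - christoffel g i j p x * christoffel g p i k x)).

Record chart (R : realType) (M : topologicalType) := Chart {
  chart_dom : set M;
  chart_map : M -> E4 R;
  chart_inv : E4 R -> M;
  chart_dom_open : open chart_dom;
  chart_img_open : open (chart_map @` chart_dom);
  chart_mapK : {in chart_dom, cancel chart_map chart_inv};
  chart_map_cont : {within chart_dom, continuous chart_map};
  chart_inv_cont : {within chart_map @` chart_dom, continuous chart_inv}
}.

Definition chart_img (R : realType) (M : topologicalType) (c : chart R M)
    : set (E4 R) := chart_map c @` chart_dom c.

Definition overlap (R : realType) (M : topologicalType) (c c' : chart R M)
    : set (E4 R) := chart_map c @` (chart_dom c `&` chart_dom c').

Definition transition (R : realType) (M : topologicalType) (c c' : chart R M)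
    : E4 R -> E4 R := chart_map c' \o chart_inv c.

(* Smooth Riemannian 4-manifolds; the metric tensor is given by its
   coefficients in the charts of an atlas, related by the tensorial
   transformation law [metric_compat]. *)
Record riemannian4 (R : realType) := Riemannian4 {
  mfd_space :> topologicalType;
  mfd_hausdorff : hausdorff_space mfd_space;
  mfd_second_countable : @second_countable mfd_space;
  mfd_index : Type;
  mfd_chart : mfd_index -> chart R mfd_space;
  mfd_cover : forall p, exists a, chart_dom (mfd_chart a) p;
  mfd_smooth : forall a b,
    smooth_on (overlap (mfd_chart a) (mfd_chart b))
              (transition (mfd_chart a) (mfd_chart b));
  mfd_metric : mfd_index -> metric_field R;
  mfd_riemannian : forall a,
    riemannian_on (chart_img (mfd_chart a)) (mfd_metric a);
  metric_compat : forall a b x X Y,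
    overlap (mfd_chart a) (mfd_chart b) x ->
    let phi := transition (mfd_chart a) (mfd_chart b) in
    inner (mfd_metric a) x X Y =
    inner (mfd_metric b) (phi x) ('D_X phi x) ('D_Y phi x)
}.

Definition scalar_flat (R : realType) (M : riemannian4 R) : Prop :=
  forall (a : mfd_index M) x, chart_img (mfd_chart a) x ->
    scalar_curvature (mfd_metric a) x = 0.

Definition tensor4 (R : realType) := 'I_4 -> 'I_4 -> 'I_4 -> 'I_4 -> R.

Definition algebraic_weyl (R : realType) (W : tensor4 R) : Prop :=
  [/\ forall i j k l, W j i k l = - W i j k l,
      forall i j k l, W i j l k = - W i j k l,
      forall i j k l, W k l i j = W i j k l,
      forall i j k l, W i j k l + W j k i l + W k i j l = 0
    & forall j l, \sum_i W i j i l = 0].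

Definition mass_tensor (R : realType) (Xi : R -> tensor4 R) : Prop :=
  forall (lam : R) (w X Y : E4 R),
    enorm w = 1 -> dot X w = 0 -> dot Y w = 0 ->
    \sum_i \sum_j \sum_k \sum_l
      Xi lam i j k l * X 0 i * Y 0 j * w 0 k * w 0 l = - (lam / 9) * dot X Y.

Definition sphere_point (R : realType) (r a b c : R) : E4 R :=
  \row_(i < 4) (r * nth 0 [:: cos a; sin a * cos b; sin a * sin b * cos c;
                              sin a * sin b * sin c] i).

(* Integral of f over {|x| = r} against the Euclidean surface measure, in
   hyperspherical coordinates, where dS = r^3 sin^2 a sin b da db dc. *)
Definition sphere_integral (R : realType) (r : R) (f : E4 R -> R) : R :=
  \int[lebesgue_measure]_(a in `[0, pi])
    \int[lebesgue_measure]_(b in `[0, pi])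
      \int[lebesgue_measure]_(c in `[0, 2 * pi])
        (f (sphere_point r a b c) * (r ^+ 3 * sin a ^+ 2 * sin b)).

Definition adm_flux (R : realType) (g : metric_field R) (r : R) : R :=
  sphere_integral r (fun x => \sum_i \sum_j
    (dmetric g j i j x - dmetric g i j j x) * (x 0 i / enorm x)).

(* 2 * pi ^+ 2 is the area of the unit 3-sphere. *)
Definition m_adm (R : realType) (g : metric_field R) : R :=
  (6 * (2 * pi ^+ 2))^-1 * lim (adm_flux g r @[r --> +oo]).

Definition coord_sphere (R : realType) (r : R) : set (E4 R) :=
  [set x | enorm x = r].

(* Local isometric embeddability into flat R^4 of the coordinate sphere of
   radius r with the metric induced by g.  Near p an embedding of the sphere is
   the restriction of a smooth map F defined on an open set V of R^4, and the
   tangent space at x is the orthogonal of x.  Immersivity follows from the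
   isometry condition. *)
Definition sphere_locally_embeddable (R : realType) (g : metric_field R)
    (r : R) : Prop :=
  forall p, coord_sphere r p ->
  exists (V : set (E4 R)) (F : E4 R -> E4 R),
    let U := V `&` coord_sphere r in
    [/\ open V /\ V p, smooth_on V F,
        exists2 G : E4 R -> E4 R, {in U, cancel F G} &
          {within F @` U, continuous G}
      & forall x X Y, U x -> dot X x = 0 -> dot Y x = 0 ->
          dot ('D_X F x) ('D_Y F x) = inner g x X Y].

(* Main.v *)
(* In the graph coordinates u |-> (u, sqrt (1 - |u|^2)) of a hemisphere of S_r,
   rescaled to unit size, the induced metric gam agrees with the round one up to
   O(r^-2) together with its first three derivatives at u = 0. If f is a local
   isometric embedding, differentiating <d_i f, d_j f> = gam_ij gives the Gauss
   equation for h_ij = <d_i d_j f, N> and its first derivative. In dimension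
   three the Gauss equation prescribes the cofactor matrix of h, hence h up to
   sign, and its derivative prescribes the normal parts of d_i d_j d_k f; both
   are O(r^-2)-close to the values of the round sphere, for which the third
   derivatives vanish. Consequently the symmetry of the third derivatives (the
   Codazzi equation) forces one component of the linearized Cotton tensor of gam,
   a linear expression in the third derivatives of gam at 0, to be O(r^-4).
   This expression kills the round metric, and on the r^-2 term
   W(d_i phi, phi, phi, d_j phi) it equals -24 W(e0, e2, e3, e1), where e0 is the
   centre of the hemisphere and (e0, e1, e2, e3) the orthonormal frame used to
   build the chart. So W(e0, e2, e3, e1) = 0 for every orthonormal frame, and an
   algebraic Weyl tensor with this property vanishes. *)
Require Import Defs.
From HB Require Import structures.
From mathcomp Require Import all_boot all_order all_algebra.
From mathcomp Require Import all_classical all_reals all_analysis.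
From mathcomp Require Import ring lra.
Import Order.TTheory GRing.Theory Num.Theory.
Import numFieldNormedType.Exports.
Set Implicit Arguments.
Unset Strict Implicit.
Local Open Scope classical_set_scope.
Local Open Scope ring_scope.

(** * Partial derivatives and smooth functions *)

Section MultivariateCalculus.
Variables (R : realType) (n : nat).
Local Notation E := 'rV[R]_n.
Implicit Types (f : E -> R^o) (x y v : E).

(** The contradiction is a comparison of orders: with delta = r^-2, the obstruction equals -24 W(e0,
    e2, e3, e1) delta up to o(delta), while an embedding bounds it by a constant times delta^2. For
    each frame only the centre of the hemisphere is examined; varying the frame replaces varying the
    point. The square comes from a cancellation. In the chosen combination of differentiated Gauss
    equations the leading terms are k_312 h_33 and k_123 h_11, where k denotes the normal part of
    the third derivatives. Symmetry of k leaves k_123 (h_33 - h_11), a product of two small numbers;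
    every other term pairs an entry of k with an off-diagonal entry of h. Since the Gauss equation
    does not see the sign of h, no sign is ever chosen: the estimates concern (det h) h, products of
    two entries, or absolute values. Inner products are taken of full second and third derivatives,
    tangential parts included, instead of covariant derivatives. The Gauss equation then has a right
    side linear in gam, and the tangential parts, themselves small, only enter quadratically when
    normal parts are extracted. *)

Lemma is_derive_line f y v (s : R) :
  derivable f (y + s *: v) v ->
  is_derive s (1 : R) (fun t : R => f (y + t *: v)) ('D_v f (y + s *: v)).
Proof.
move=> df.
have E0 : (fun h : R => h^-1 *: (((fun t : R => f (y + t *: v)) \o shift s) (h *: 1) -
      f (y + s *: v)))
   = (fun h : R => h^-1 *: ((f \o shift (y + s *: v)) (h *: v) - f (y + s *: v))).
  apply/funext => h /=; congr (_ *: (f _ - _)).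
  by rewrite /= [h *: 1]mulr1 scalerDl addrCA.
by apply: DeriveDef; rewrite /derivable /derive E0.
Qed.

(** The two difference quotients are literally equal, so derivability in the single direction [v]
    suffices. *)
Lemma is_derive_translate f y v (c : E) :
  derivable f (y + c) v ->
  is_derive y v (fun z => f (z + c)) ('D_v f (y + c)).
Proof.
move=> df.
have E0 : (fun h : R => h^-1 *: (((fun z => f (z + c)) \o shift y) (h *: v) -
      f (y + c)))
   = (fun h : R => h^-1 *: ((f \o shift (y + c)) (h *: v) - f (y + c))).
  by apply/funext => h /=; rewrite addrA.
by apply: DeriveDef; rewrite /derivable /derive E0.
Qed.

(** Both signs of [t] are allowed because [t] will be a coordinate of an arbitrary increment. *)
Lemma MVT_line f y v (t : R) :
  (forall s, `|s| <= `|t| -> derivable f (y + s *: v) v) ->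
  exists2 s, `|s| <= `|t| & f (y + t *: v) - f y = t * 'D_v f (y + s *: v).
Proof.
move=> df.
pose g s := f (y + s *: v).
have dg s : `|s| <= `|t| -> is_derive s (1 : R) g ('D_v f (y + s *: v)).
  by move=> /df; exact: is_derive_line.
have cg (a b : R) : (forall s, a <= s <= b -> `|s| <= `|t|) ->
    {within `[a, b], continuous (g : R -> R)}.
  move=> ab; apply: derivable_within_continuous => s; rewrite in_itv /= => /ab.
  by move=> /dg [].
have [t0|t0] := leP 0 t.
- have [||s] := @MVT_segment R g (fun s => 'D_v f (y + s *: v)) 0 t t0.
  + move=> s; rewrite in_itv /= => /andP[s0 st]; apply: dg.
    by rewrite !ger0_norm // ltW.
  + by apply: cg => s /andP[s0 st]; rewrite !ger0_norm.
  rewrite in_itv /= => /andP[s0 st]; rewrite /g scale0r addr0 subr0 => ->.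
  by exists s; rewrite ?ger0_norm // mulrC.
- have [||s] := @MVT_segment R g (fun s => 'D_v f (y + s *: v)) t 0 (ltW t0).
  + move=> s; rewrite in_itv /= => /andP[s0 st]; apply: dg.
    by rewrite !ler0_norm ?lerN2 // ltW.
  + by apply: cg => s /andP[s0 st]; rewrite !ler0_norm ?lerN2 // ltW.
  rewrite in_itv /= => /andP[s0 st]; rewrite /g scale0r addr0 sub0r => H.
  exists s; first by rewrite !ler0_norm ?lerN2 // ltW.
  by rewrite -opprB H; ring.
Qed.

Lemma normr_coord x i : `|x 0 i| <= `|x|.
Proof.
rewrite [leRHS]/Num.Def.normr /= mx_normrE.
by apply: (le_bigmax _ (fun ij : 'I_1 * 'I_n => `|x ij.1 ij.2|) (0, i)).
Qed.

Lemma normr_le_coord x (M : R) : 0 <= M -> (forall i, `|x 0 i| <= M) -> `|x| <= M.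
Proof.
move=> M0 xM; rewrite [leLHS]/Num.Def.normr /= mx_normrE.
by apply/bigmax_leP; split => // -[i j] _ /=; rewrite ord1.
Qed.

(** The candidate for the differential, meaningful before differentiability is known. *)
Definition gradient f x (h : E) : R^o := \sum_i h 0 i * 'D_(delta_mx 0 i) f x.

Fact gradient_is_linear f x : linear (gradient f x).
Proof.
move=> a u v; rewrite /gradient /GRing.scale /= mulr_sumr -big_split /=.
by apply: eq_bigr => i _; rewrite !mxE mulrDl mulrA.
Qed.
HB.instance Definition _ f x :=
  GRing.isLinear.Build R E R^o _ (gradient f x) (gradient_is_linear f x).

(* Telescope along the coordinates and apply the mean value theorem to each
   term; the sup norm keeps all intermediate points within |h| of x. *)
Lemma increment_coord f x (h : E) (e : R) :
  (forall y, `|y - x| <= `|h| -> forall i, derivable f y (delta_mx 0 i)) ->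
  (forall y, `|y - x| <= `|h| ->
     forall i, `|'D_(delta_mx 0 i) f y - 'D_(delta_mx 0 i) f x| <= e) ->
  `|f (h + x) - f x - gradient f x h| <= e * `|h| *+ n.
Proof.
move=> df dfe.
pose hk k : E := \row_i (if (i < k)%N then h 0 i else 0).
have hk0 : hk 0%N = 0 by apply/rowP => i; rewrite !mxE.
have hkn : hk n = h by apply/rowP => i; rewrite !mxE ltn_ord.
have hkS (k : 'I_n) : hk k.+1 = hk k + h 0 k *: delta_mx 0 k.
  apply/rowP => i; rewrite !mxE /= ltnS leq_eqVlt.
  case: (ltngtP i k) => [ik|ki|/val_inj ->] /=.
  - by rewrite -val_eqE (ltn_eqF ik) mulr0 addr0.
  - by rewrite -val_eqE (gtn_eqF ki) mulr0 addr0.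
  - by rewrite eqxx mulr1 add0r.
have -> : f (h + x) - f x = \sum_(k < n) (f (x + hk k.+1) - f (x + hk k)).
  rewrite -(big_mkord xpredT (fun k => f (x + hk k.+1) - f (x + hk k))).
  by rewrite (telescope_sumr (fun k => f (x + hk k)) (leq0n n)) hk0 hkn addr0 [x + h]addrC.
rewrite /gradient -sumrB (le_trans (ler_norm_sum _ _ _)) //.
have -> : e * `|h| *+ n = \sum_(k < n) e * `|h| by rewrite sumr_const card_ord.
apply: ler_sum => k _.
have near_x (s : R) : `|s| <= `|h 0 k| -> `|x + hk k + s *: delta_mx 0 k - x| <= `|h|.
  move=> sh; rewrite addrAC [x + _]addrC addrK; apply: normr_le_coord => // i.
  rewrite !mxE /=; case: (ltngtP i k) => [ik|ki|/val_inj ->].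
  - by rewrite -val_eqE (ltn_eqF ik) mulr0 addr0 normr_coord.
  - by rewrite -val_eqE (gtn_eqF ki) mulr0 addr0 normr0.
  - by rewrite eqxx mulr1 add0r (le_trans sh) // normr_coord.
have [s sh] := @MVT_line f (x + hk k) (delta_mx 0 k) (h 0 k)
  (fun s sh => df _ (near_x s sh) k).
rewrite hkS addrA => ->; rewrite -mulrBr normrM mulrC.
by apply: ler_pM => //; [apply/dfe/near_x | exact: normr_coord].
Qed.

(** [smooth_on] only speaks of partial derivatives along the axes; this is the passage to the
    differential, on which the chain rule rests. *)
Lemma differentiable_C1 f x :
  (\forall y \near x, forall i, derivable f y (delta_mx 0 i)) ->
  (forall i, {for x, continuous (fun y => 'D_(delta_mx 0 i) f y)}) ->
  differentiable f x.
Proof.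
move=> df cf.
have Lc : continuous (gradient f x).
  move=> u; apply: differentiable_continuous.
  suff -> : gradient f x = \sum_i ('D_(delta_mx 0 i) f x *: (fun h : E => h 0 i : R^o)).
    by apply: differentiable_sum => i; apply: differentiableZ; exact: differentiable_coord.
  apply/funext => h; rewrite /gradient fct_sumE; apply: eq_bigr => i _.
  by rewrite mulrC.
suff Lo : f \o shift x = cst (f x) + (gradient f x : E -> R^o) +o_ (0 : E) (@id E).
  apply/diff_locallyP; rewrite (diff_unique Lc Lo); split => //.
apply/eqaddoP => e e0.
(* The error bound has [n] equal terms; dividing by [n.+1] also covers [n = 0]. *)
pose e' := e / n.+1%:R.
have e'0 : 0 < e' by rewrite divr_gt0.
have dfe : \forall y \near x,
    forall i, `|'D_(delta_mx 0 i) f y - 'D_(delta_mx 0 i) f x| <= e'.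
  apply: (@filter_forall E 'I_n (fun i y => `|'D_(delta_mx 0 i) f y - 'D_(delta_mx 0 i) f x| <= e') (nbhs x) _) => i.
  move/cvgrPdist_le : (cf i) => /(_ e' e'0).
  by apply: filterS => y; rewrite distrC.
have [d /= d0 xd] := (nbhs_ballP x _).1 (filterI df dfe).
near=> h; rewrite /= opprD addrA.
have hd : `|h| < d by near: h; exact: (@nbhs0_lt R E d d0).
have ball_xd y : `|y - x| <= `|h| -> ball x d y.
  by move=> yx; rewrite -ball_normE /= distrC (le_lt_trans yx).
apply: le_trans (@increment_coord f x h e' _ _) _.
- by move=> y /ball_xd /xd [].
- by move=> y /ball_xd /xd [].
rewrite /e' -mulrnAl; apply: ler_wpM2r => //.
rewrite -mulrnAr ler_piMr ?(ltW e0) // -[X in X <= _]mulr_natl.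
by rewrite ler_pdivrMr ?ltr0n // mul1r ler_nat.
Unshelve. all: by end_near. Qed.

(** The second difference of [f] over a small parallelogram does not depend on the order of the two
    steps. The mean value theorem expresses it through either mixed derivative at some point of the
    parallelogram, and continuity at [x] does the rest. *)
Lemma Schwarz f x u v :
  (\forall y \near x, [/\ derivable f y u, derivable f y v,
     derivable (fun z => 'D_u f z) y v & derivable (fun z => 'D_v f z) y u]) ->
  {for x, continuous (fun y => 'D_v (fun z => 'D_u f z) y)} ->
  {for x, continuous (fun y => 'D_u (fun z => 'D_v f z) y)} ->
  'D_v (fun z => 'D_u f z) x = 'D_u (fun z => 'D_v f z) x.
Proof.
move=> df cvu cuv.
pose g w1 w2 y := 'D_w2 (fun z => 'D_w1 f z) y : R.
suff : forall e, 0 < e -> `|g u v x - g v u x| <= e.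
  move=> H; apply/eqP; rewrite -subr_eq0 -normr_le0.
  by apply/ler_addgt0Pr => e e0; rewrite add0r; exact: H.
move=> e e0.
have e20 : 0 < e / 2 by rewrite divr_gt0.
move/cvgrPdist_le : cvu => /(_ _ e20) cvu.
move/cvgrPdist_le : cuv => /(_ _ e20) cuv.
have [d /= d0 xd] := (nbhs_ballP x _).1 (filterI df (filterI cvu cuv)).
(* With [t * M = d / 2] the whole parallelogram stays in the ball of radius [d]; the summand 1 keeps
   [M] positive when [u = v = 0]. *)
pose M := 1 + `|u| + `|v|.
have M0 : 0 < M by rewrite /M -addrA ltr_pwDl ?ltr01 // addr_ge0.
pose t := d / 2 / M.
have t0 : 0 < t by rewrite !divr_gt0.
have inball (a b : R) : `|a| <= `|t| -> `|b| <= `|t| -> ball x d (x + a *: u + b *: v).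
  rewrite (gtr0_norm t0) => at_ bt.
  rewrite -ball_normE /= !opprD !addrA subrr add0r.
  apply: le_lt_trans (ler_normB _ _) _; rewrite normrN !normrZ.
  apply: (@le_lt_trans _ _ (t * M)); last first.
    by rewrite /t divfK ?gt_eqF // ltr_pdivrMr // ltr_pMr // ltr1n.
  rewrite /M mulrDr mulrDr mulr1 lerD // ?ler_wpM2r //.
  by rewrite (le_trans (ler_wpM2r _ at_)) // lerDr ltW.
(* Two uses of the mean value theorem: first along [w1] for the difference [F] of [f] in direction
   [w2], then along [w2] for the derivative of [f] along [w1]. *)
have step (w1 w2 : E) :
   (forall a b : R, `|a| <= `|t| -> `|b| <= `|t| ->
      derivable f (x + a *: w1 + b *: w2) w1 /\
      derivable (fun z => 'D_w1 f z) (x + a *: w1 + b *: w2) w2) ->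
   exists a b, [/\ `|a| <= `|t|, `|b| <= `|t| &
    f (x + t *: w1 + t *: w2) - f (x + t *: w1) - (f (x + t *: w2) - f x)
    = t * (t * g w1 w2 (x + a *: w1 + b *: w2))].
  move=> dw.
  pose F z := f (z + t *: w2) - f z.
  have sh (a : R) : `|a| <= `|t| -> is_derive (x + a *: w1) w1 F
     ('D_w1 f (x + a *: w1 + t *: w2) - 'D_w1 f (x + a *: w1)).
    move=> ha; apply: is_deriveB.
    - exact: (@is_derive_translate f (x + a *: w1) w1 (t *: w2) (dw a t ha (lexx _)).1).
    - have := dw a 0 ha; rewrite normr0 scale0r addr0 => /(_ (normr_ge0 _)) [+ _].
      exact: derivableP.
  have [a at_ Fa] := @MVT_line F x w1 t (fun a ha => (sh a ha).(ex_derive)).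
  have [b bt Gb] := @MVT_line (fun z => 'D_w1 f z) (x + a *: w1) w2 t
     (fun b hb => (dw a b at_ hb).2).
  exists a, b; split => //.
  rewrite /g -Gb; have [_ <-] := sh a at_.
  by rewrite -Fa /F addrAC.
have [|a [b [ha hb Eab]]] := step u v.
  move=> a b ha hb; have [[d1 d2 d3 d4] _] := xd _ (inball a b ha hb).
  exact: (conj d1 d3).
have [|b' [a' [hb' ha' Eab']]] := step v u.
  move=> a1 b1 ha1 hb1; rewrite addrAC; have [[d1 d2 d3 d4] _] := xd _ (inball b1 a1 hb1 ha1).
  exact: (conj d2 d4).
have tn0 : t != 0 by rewrite gt_eqF.
have four_point (p q r s : R) : p - q - (r - s) = p - r - (q - s) by ring.
have gE : g u v (x + a *: u + b *: v) = g v u (x + a' *: u + b' *: v).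
  apply: (mulfI tn0); apply: (mulfI tn0).
  rewrite (addrAC x (a' *: u)).
  apply: etrans (esym Eab) (etrans _ Eab'); rewrite (addrAC x (t *: v)).
  exact: four_point.
have [_ [h1 _]] := xd _ (inball a b ha hb).
have [_ [_ h2]] := xd _ (inball a' b' ha' hb').
rewrite (splitr e); apply: (le_trans (ler_distD (g u v (x + a *: u + b *: v)) _ _)).
by apply: lerD; [exact: h1 | rewrite gE distrC; exact: h2].
Qed.

End MultivariateCalculus.

(** * Smooth functions on open sets of R^4 and their closure properties *)

Section SmoothFunctions.
Variable R : realType.
Implicit Types (U : set (E4 R)) (f g h : E4 R -> R^o) (x u v : E4 R) (s : seq 'I_4).
Local Notation e_ i := (delta_mx 0 i : E4 R).

Lemma pd_cat s1 s2 f : pd (s1 ++ s2) f = pd s1 (pd s2 f).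
Proof. exact: foldr_cat. Qed.

Lemma near_open U x (P : E4 R -> Prop) :
  open U -> U x -> (forall y, U y -> P y) -> \forall y \near x, P y.
Proof. by move=> oU Ux UP; apply: filterS UP (open_nbhs_nbhs (conj oU Ux)). Qed.

Lemma pd_eq_on U f g s : open U -> (forall x, U x -> f x = g x) ->
  forall x, U x -> pd s f x = pd s g x.
Proof.
move=> oU fg; elim: s => [//|i s IH] x Ux /=.
by apply: near_eq_derive; exact: near_open oU Ux IH.
Qed.

(* Bisimulation principle for smoothness: on U, members of P are continuous and
   their partial derivatives agree with members of P. *)
Definition smooth_step U (P : (E4 R -> R^o) -> Prop) := forall f, P f ->
  (forall x, U x -> {for x, continuous f}) /\
  forall i, exists2 g, P g & forall x, U x -> is_derive x (e_ i) f (g x).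

(** By induction on [s], [pd s f] agrees on [U] with some member of [P]; as [U] is open, continuity
    and derivability of that member carry over. *)
Lemma smooth_on_coind U P : open U -> smooth_step U P ->
  forall f, P f -> smooth_on U f.
Proof.
move=> oU step f Pf s.
have [g Pg fg] : exists2 g, P g & forall x, U x -> pd s f x = g x.
  elim: s => [|i s [g Pg fg]]; first by exists f.
  have [_ /(_ i) [g' Pg' gg']] := step _ Pg.
  exists g' => // x Ux /=; rewrite -(gg' x Ux).(derive_val).
  by apply: near_eq_derive; exact: near_open oU Ux fg.
move=> x Ux; have [cg dg] := step _ Pg.
have nfg : {near x, g =1 pd s f}.
  by apply: (near_open oU Ux) => y Uy; rewrite fg.
split.
  change (pd s f @ x --> pd s f x); rewrite (fg x Ux); apply: cvg_trans (cg x Ux).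
  exact: near_eq_cvg nfg.
move=> i; apply: near_eq_derivable nfg _.
by have [g' _ gg'] := dg i; exact: (gg' x Ux).(ex_derive).
Qed.

Section Open.
Variables (U : set (E4 R)) (oU : open U).

Lemma smooth_pd f s : smooth_on U f -> smooth_on U (pd s f).
Proof. by move=> sf s' x Ux; rewrite -pd_cat; exact: sf. Qed.

Lemma smooth_continuous f x : smooth_on U f -> U x -> {for x, continuous f}.
Proof. by move=> sf Ux; have [] := sf [::] x Ux. Qed.

Lemma smooth_is_derive f i x : smooth_on U f -> U x ->
  is_derive x (e_ i) f (pd [:: i] f x).
Proof. by move=> sf Ux; apply: derivableP; have [_] := sf [::] x Ux. Qed.

Lemma smooth_differentiable f x : smooth_on U f -> U x -> differentiable f x.
Proof.
move=> sf Ux; apply: differentiable_C1.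
  by apply: (near_open oU Ux) => y Uy i; have [_] := sf [::] y Uy.
by move=> i; have [] := sf [:: i] x Ux.
Qed.

Lemma smooth_step_smooth : smooth_step U (fun f => smooth_on U f).
Proof.
move=> f sf; split; first by move=> x Ux; exact: smooth_continuous.
by move=> i; exists (pd [:: i] f); [exact: smooth_pd | move=> x; exact: smooth_is_derive].
Qed.

Lemma pdC f i j x : smooth_on U f -> U x -> pd [:: i; j] f x = pd [:: j; i] f x.
Proof.
move=> sf Ux; apply: (@Schwarz R 4 f x (e_ j) (e_ i)).
- apply: (near_open oU Ux) => y Uy.
  by split; [have [_] := sf [::] y Uy|have [_] := sf [::] y Uy|
    have [_] := sf [:: j] y Uy|have [_] := sf [:: i] y Uy].
- by have [] := sf [:: i; j] x Ux.
- by have [] := sf [:: j; i] x Ux.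
Qed.

End Open.

Lemma derive_gradient h x v : differentiable h x ->
  'D_v h x = \sum_a v 0 a * pd [:: a] h x.
Proof.
move=> dh; rewrite deriveE // {1}(row_sum_delta v) linear_sum.
by apply: eq_bigr => a _; rewrite linearZ /= deriveE.
Qed.

Lemma differentiable_row (phi : 'I_4 -> E4 R -> R^o) x :
  (forall a, differentiable (phi a) x) -> differentiable (fun y => \row_a phi a y) x.
Proof.
move=> dphi.
have -> : (fun y => \row_a phi a y) = \sum_a (fun y => phi a y *: e_ a).
  apply/funext => y; rewrite fct_sumE [LHS]row_sum_delta.
  by apply: eq_bigr => a _; rewrite mxE.
by apply: differentiable_sum => a; exact: differentiableZl.
Qed.

Lemma is_derive_comp (phi : 'I_4 -> E4 R -> R^o) h x v :
  (forall a, differentiable (phi a) x) ->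
  differentiable h (\row_a phi a x) ->
  is_derive x v (fun y => h (\row_a phi a y))
    (\sum_a 'D_v (phi a) x * pd [:: a] h (\row_a phi a x)).
Proof.
move=> dphi dh.
have dPhi := differentiable_row dphi.
have dc : differentiable (fun y => h (\row_a phi a y)) x.
  exact: (@differentiable_comp _ _ _ _ (fun y => \row_a phi a y) h).
apply: DeriveDef; first exact: diff_derivable.
rewrite deriveE // (@diff_comp _ _ _ _ (fun y => \row_a phi a y) h) //=.
rewrite -!deriveE // derive_gradient // derive_mx; last exact: diff_derivable.
apply: eq_bigr => a _; rewrite !mxE; congr (_ * _).
by congr ('D_v _ x); apply/funext => y; rewrite mxE.
Qed.

Section SmoothAlgebra.
Variables (U : set (E4 R)) (oU : open U).

(* [alg_ode] adjoins solutions of d_i k = a_i k^m, which covers reciprocals and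
   inverse square roots. *)
Inductive smooth_alg : (E4 R -> R^o) -> Prop :=
| alg_smooth f : smooth_on U f -> smooth_alg f
| alg_add f g : smooth_alg f -> smooth_alg g -> smooth_alg (fun x => f x + g x)
| alg_mul f g : smooth_alg f -> smooth_alg g -> smooth_alg (fun x => f x * g x)
| alg_comp (V : set (E4 R)) h (phi : 'I_4 -> E4 R -> R^o) : open V -> smooth_on V h ->
    (forall a, smooth_on U (phi a)) -> (forall x, U x -> V (\row_a phi a x)) ->
    smooth_alg (fun x => h (\row_a phi a x))
| alg_ode (k : E4 R -> R^o) (a : 'I_4 -> E4 R -> R^o) m :
    (forall x, U x -> {for x, continuous k}) -> (forall i, smooth_on U (a i)) ->
    (forall i x, U x -> is_derive x (e_ i) k (a i x * k x ^+ m)) -> smooth_alg k.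

Lemma smooth_cst (c : R) : smooth_on U (fun=> c : R^o).
Proof.
apply: (@smooth_on_coind U (fun f => exists c : R, f = fun=> c)) => //; last by exists c.
move=> f [d ->]; split; first by move=> x _; exact/differentiable_continuous/differentiable_cst.
by move=> i; exists (fun=> 0); [exists 0 | move=> x _; exact: is_derive_cst].
Qed.

Lemma smooth_alg_exp f m : smooth_alg f -> smooth_alg (fun x => f x ^+ m).
Proof.
move=> af; elim: m => [|m IH].
  by under eq_fun do rewrite expr0; exact/alg_smooth/smooth_cst.
by under eq_fun do rewrite exprS; exact: alg_mul.
Qed.

Lemma smooth_alg_sum (I : Type) (r : seq I) (F : I -> E4 R -> R^o) :
  (forall i, smooth_alg (F i)) -> smooth_alg (fun x => \sum_(i <- r) F i x).
Proof.
move=> aF; elim: r => [|i r IH].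
  by under eq_fun do rewrite big_nil; exact/alg_smooth/smooth_cst.
by under eq_fun do rewrite big_cons; exact: alg_add.
Qed.

(** The derivative of each constructor is again built from constructors. For a composition it is a
    sum of products with [pd [:: a] h] composed with the same inner map; for [alg_ode] it is the
    given right side, in which [k] itself reappears. *)
Lemma smooth_alg_step : smooth_step U smooth_alg.
Proof.
move=> f; elim=> {f} [f sf|f g _ [cf df] _ [cg dg]|f g af [cf df] ag [cg dg]
  |V h phi oV sh sphi UV|k a m ck sa dk].
- have [cf df] := smooth_step_smooth sf; split => // i.
  by have [g sg fg] := df i; exists g => //; exact: alg_smooth.
- split; first by move=> x Ux; exact: (cvgD (cf x Ux) (cg x Ux)).
  move=> i; have [f' af' ff'] := df i; have [g' ag' gg'] := dg i.
  exists (fun x => f' x + g' x); first exact: alg_add.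
  by move=> x Ux; apply: is_deriveD; [exact: ff' | exact: gg'].
- split; first by move=> x Ux; exact: (cvgM (cf x Ux) (cg x Ux)).
  move=> i; have [f' af' ff'] := df i; have [g' ag' gg'] := dg i.
  exists (fun x => f x * g' x + g x * f' x).
    by apply: alg_add; exact: alg_mul.
  by move=> x Ux; apply: is_deriveM; [exact: ff' | exact: gg'].
- have dphi x a : U x -> differentiable (phi a) x.
    by move=> Ux; apply: (smooth_differentiable oU).
  have dh x : U x -> differentiable h (\row_a phi a x).
    by move=> Ux; apply: (smooth_differentiable oV) => //; exact: UV.
  have dc x i : U x -> is_derive x (e_ i) (fun y => h (\row_a phi a y))
     (\sum_a pd [:: i] (phi a) x * pd [:: a] h (\row_a phi a x)).
    by move=> Ux; apply: is_derive_comp => [a|]; [exact: dphi | exact: dh].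
  split.
    move=> x Ux; apply: (@continuous_comp _ _ _ (fun y => \row_a phi a y) h).
      by apply/differentiable_continuous/differentiable_row => a; exact: dphi.
    exact/differentiable_continuous/dh.
  move=> i.
  exists (fun x => \sum_a pd [:: i] (phi a) x * pd [:: a] h (\row_a phi a x)).
    apply: smooth_alg_sum => a; apply: alg_mul; first exact/alg_smooth/smooth_pd.
    exact: (alg_comp oV (smooth_pd [:: a] sh) sphi UV).
  by move=> x; exact: dc.
- split => // i; exists (fun x => a i x * k x ^+ m); last exact: dk.
  apply: alg_mul; first exact: alg_smooth.
  by apply: smooth_alg_exp; exact: alg_ode dk.
Qed.

Lemma smooth_alg_on f : smooth_alg f -> smooth_on U f.
Proof. exact/smooth_on_coind/smooth_alg_step. Qed.

Lemma smoothD f g : smooth_on U f -> smooth_on U g -> smooth_on U (fun x => f x + g x).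
Proof. by move=> sf sg; apply/smooth_alg_on/alg_add; exact: alg_smooth. Qed.

Lemma smoothM f g : smooth_on U f -> smooth_on U g -> smooth_on U (fun x => f x * g x).
Proof. by move=> sf sg; apply/smooth_alg_on/alg_mul; exact: alg_smooth. Qed.

Lemma smooth_sum (I : Type) (r : seq I) (F : I -> E4 R -> R^o) :
  (forall i, smooth_on U (F i)) -> smooth_on U (fun x => \sum_(i <- r) F i x).
Proof. by move=> sF; apply/smooth_alg_on/smooth_alg_sum => i; exact: alg_smooth. Qed.

Lemma smooth_comp V h (phi : 'I_4 -> E4 R -> R^o) : open V -> smooth_on V h ->
  (forall a, smooth_on U (phi a)) -> (forall x, U x -> V (\row_a phi a x)) ->
  smooth_on U (fun x => h (\row_a phi a x)).
Proof. by move=> oV sh sphi UV; apply/smooth_alg_on; exact: (alg_comp oV). Qed.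

Lemma is_derive_coord x v a : is_derive x v (fun y => y 0 a : R^o) (v 0 a).
Proof.
have E0 : (fun h : R => h^-1 *: (((fun y => y 0 a : R^o) \o shift x) (h *: v) - x 0 a))
  @ 0^' --> (v 0 a : R^o).
  apply: (@cvg_trans _ ((fun=> v 0 a : R^o) @ (0:R)^')); last exact: cvg_cst.
  apply: near_eq_cvg; near=> h.
  rewrite /= !mxE addrK.
  by rewrite /GRing.scale /= mulrA mulVf ?mul1r //; near: h; exact: nbhs_dnbhs_neq.
by apply: DeriveDef; [apply/cvg_ex; exists (v 0 a) | exact: cvg_lim E0].
Unshelve. all: by end_near. Qed.

Lemma smooth_coord a : smooth_on U (fun x => x 0 a : R^o).
Proof.
apply: (@smooth_on_coind U (fun f => (exists c : R, f = fun=> c) \/ f = fun x => x 0 a)) => //;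
  last by right.
move=> f [[c ->]|->].
  split; first by move=> x _; exact/differentiable_continuous/differentiable_cst.
  by move=> i; exists (fun=> 0); [left; exists 0 | move=> x _; exact: is_derive_cst].
split; first by move=> x _; exact: coord_continuous.
move=> i; exists (fun=> e_ i 0 a); first by left; exists (e_ i 0 a).
by move=> x _; exact: is_derive_coord.
Qed.

Lemma pd_cst s (c : R) x : U x -> pd s (fun=> c : R^o) x = if s is [::] then c else 0.
Proof.
(* The last index of [s] is the innermost derivative, the one that kills the constant; hence the
   split from the right. *)
case/lastP: s => [//|s i] Ux; rewrite -cats1 pd_cat.
have -> : pd [:: i] (fun=> c : R^o) = fun=> 0.
  by apply/funext => y /=; rewrite derive_cst.
have -> : (if s ++ [:: i] is [::] then c else 0) = 0 by case: s.
elim: s x Ux => [//|j s IH] x Ux /=.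
rewrite -[RHS](derive_cst (0 : R^o) x (e_ j)).
by apply: near_eq_derive; exact: near_open oU Ux IH.
Qed.

Lemma pdD f g s x : smooth_on U f -> smooth_on U g -> U x ->
  pd s (fun y => f y + g y) x = pd s f x + pd s g x.
Proof.
move=> sf sg; elim: s x => [//|i s IH] x Ux.
rewrite -[LHS]/('D_(e_ i) (pd s (fun y => f y + g y)) x).
rewrite (near_eq_derive _ (near_open oU Ux IH)).
apply/derive_val; apply: (is_deriveD (smooth_is_derive i _ Ux) (smooth_is_derive i _ Ux));
  exact: smooth_pd.
Qed.

Lemma pd_sum (I : Type) (r : seq I) (F : I -> E4 R -> R^o) s x :
  (forall i, smooth_on U (F i)) -> U x ->
  pd s (fun y => \sum_(i <- r) F i y) x = \sum_(i <- r) pd s (F i) x.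
Proof.
move=> sF Ux; elim: r => [|i r IH].
  rewrite big_nil; under eq_fun do rewrite big_nil.
  by rewrite pd_cst //; case: s.
rewrite big_cons; under eq_fun do rewrite big_cons.
by rewrite pdD // ?IH //; exact: smooth_sum.
Qed.

Lemma pd1M f g i x : smooth_on U f -> smooth_on U g -> U x ->
  pd [:: i] (fun y => f y * g y) x = pd [:: i] f x * g x + f x * pd [:: i] g x.
Proof.
move=> sf sg Ux.
have df := smooth_is_derive i sf Ux; have dg := smooth_is_derive i sg Ux.
transitivity (f x *: pd [:: i] g x + g x *: pd [:: i] f x).
  exact: (is_deriveM df dg).(derive_val).
by rewrite addrC; congr (_ + _); exact: mulrC.
Qed.

Lemma pdZ (c : R) f s x : smooth_on U f -> U x ->
  pd s (fun y => c * f y) x = c * pd s f x.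
Proof.
move=> sf; elim: s x => [//|i s IH] x Ux.
rewrite -[LHS]/('D_(e_ i) (pd s (fun y => c * f y)) x).
rewrite (near_eq_derive _ (near_open oU Ux IH)).
have sc : smooth_on U (fun=> c : R^o) by exact: smooth_cst.
apply: etrans (pd1M i sc (smooth_pd s sf) Ux) _.
by rewrite pd_cst // mul0r add0r.
Qed.

Lemma smoothZ (c : R) f : smooth_on U f -> smooth_on U (fun x => c * f x).
Proof. by move=> sf; exact: smoothM (smooth_cst c) sf. Qed.

Let subE f g : (fun x => f x - g x) = (fun x => f x + (-1) * g x).
Proof. by apply/funext => x; congr (_ + _); rewrite mulN1r. Qed.

Lemma smoothB f g : smooth_on U f -> smooth_on U g -> smooth_on U (fun x => f x - g x).
Proof. by move=> sf sg; rewrite subE; exact: smoothD sf (smoothZ _ sg). Qed.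

Lemma pdB f g s x : smooth_on U f -> smooth_on U g -> U x ->
  pd s (fun y => f y - g y) x = pd s f x - pd s g x.
Proof.
by move=> sf sg Ux; rewrite subE (pdD _ sf (smoothZ _ sg) Ux) (pdZ _ _ sg Ux) mulN1r.
Qed.

End SmoothAlgebra.
End SmoothFunctions.

(** * The Gauss equation near the round sphere *)

Section DotProduct.
Variable R : realType.
Implicit Types (x y z : E4 R).

Lemma dotE x y : dot x y = (x *m y^T) 0 0.
Proof. by rewrite mxE; apply: eq_bigr => i _; rewrite mxE. Qed.

Lemma dotC x y : dot x y = dot y x.
Proof. by apply: eq_bigr => i _; rewrite mulrC. Qed.

Lemma dotDl x y z : dot (x + y) z = dot x z + dot y z.
Proof. by rewrite -big_split; apply: eq_bigr => i _; rewrite mxE mulrDl. Qed.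

Lemma dotZl (k : R) x y : dot (k *: x) y = k * dot x y.
Proof. by rewrite mulr_sumr; apply: eq_bigr => i _; rewrite mxE mulrA. Qed.

Lemma dotDr x y z : dot x (y + z) = dot x y + dot x z.
Proof. by rewrite ![dot x _]dotC dotDl. Qed.

Lemma dotZr (k : R) x y : dot x (k *: y) = k * dot x y.
Proof. by rewrite ![dot x _]dotC dotZl. Qed.

Lemma dotBl x y z : dot (x - y) z = dot x z - dot y z.
Proof. by rewrite -scaleN1r dotDl dotZl mulN1r. Qed.

Lemma dotBr x y z : dot x (y - z) = dot x y - dot x z.
Proof. by rewrite ![dot x _]dotC dotBl. Qed.

Lemma dot0l x : dot 0 x = 0.
Proof. by rewrite -(scale0r x) dotZl mul0r. Qed.

Lemma dot_suml (I : Type) (r : seq I) (F : I -> E4 R) x :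
  dot (\sum_(i <- r) F i) x = \sum_(i <- r) dot (F i) x.
Proof.
elim: r => [|i r IH]; first by rewrite !big_nil dot0l.
by rewrite !big_cons dotDl IH.
Qed.

Lemma dot_sumr (I : Type) (r : seq I) (F : I -> E4 R) x :
  dot x (\sum_(i <- r) F i) = \sum_(i <- r) dot x (F i).
Proof. by rewrite dotC dot_suml; apply: eq_bigr => i _; rewrite dotC. Qed.

Lemma dot_ge0 x : 0 <= dot x x.
Proof. by apply: sumr_ge0 => i _; rewrite -expr2 sqr_ge0. Qed.

Lemma dot_eq0 x : (dot x x == 0) = (x == 0).
Proof.
apply/eqP/eqP => [x0|->]; last exact: dot0l.
apply/rowP => i; rewrite mxE; apply/eqP; rewrite -sqrf_eq0 expr2.
by apply/eqP/(psumr_eq0P _ x0) => // j _; rewrite -expr2 sqr_ge0.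
Qed.

Lemma dot_young x y : 2 * `|dot x y| <= dot x x + dot y y.
Proof.
have := dot_ge0 (x + y); have := dot_ge0 (x - y).
rewrite !(dotBl, dotBr, dotDl, dotDr) [dot y x]dotC.
have [xy|xy] := leP 0 (dot x y); [rewrite ger0_norm | rewrite ltr0_norm] => //; lra.
Qed.

End DotProduct.

(** * Perturbation of symmetric 3 x 3 matrices and their cofactors *)

Section NearlyRoundHypersurface.
Variable R : realType.

Lemma normrM_le (x y a b : R) : `|x| <= a -> `|y| <= b -> `|x * y| <= a * b.
Proof. by move=> xa yb; rewrite normrM ler_pM. Qed.

(** Expansion around the identity matrix: the linear part is at most [2 * e], and with [e <= 100^-1]
    the products of errors fit into the remaining [e]. The next two lemmas follow the same
    pattern. *)
Lemma near1_minor (x y z w e : R) : e <= 100^-1 -> `|x - 1| <= e -> `|y - 1| <= e ->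
  `|z| <= e -> `|w| <= e -> `|x * y - z * w - 1| <= 3 * e.
Proof.
move=> e1 hx hy hz hw; have e0 : 0 <= e by exact: le_trans hx.
have -> : x * y - z * w - 1 = (x - 1) * (y - 1) + (x - 1) + (y - 1) - z * w by ring.
have ee : e * e <= 100^-1 * e by rewrite ler_wpM2r.
have := normrM_le hx hy; have := normrM_le hz hw; move: hx hy.
by rewrite !ler_norml; lra.
Qed.

Lemma near0_minor (x z v w e : R) : e <= 100^-1 -> `|x - 1| <= e ->
  `|z| <= e -> `|w| <= e -> `|v| <= e -> `|z * w - v * x| <= 3 * e.
Proof.
move=> e1 hx hz hw hv; have e0 : 0 <= e by exact: le_trans hx.
have -> : z * w - v * x = z * w - v * (x - 1) - v by ring.
have ee : e * e <= 100^-1 * e by rewrite ler_wpM2r.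
have := normrM_le hv hx; have := normrM_le hz hw; move: hv.
by rewrite !ler_norml; lra.
Qed.

Lemma near1_det (x y z u v w e : R) : e <= 100^-1 -> `|x - 1| <= e -> `|y - 1| <= e ->
  `|z - 1| <= e -> `|u| <= e -> `|v| <= e -> `|w| <= e ->
  `|x * y * z + 2 * (u * v * w) - x * w * w - y * v * v - z * u * u - 1| <= 5 * e.
Proof.
move=> e1 hx hy hz hu hv hw; have e0 : 0 <= e by exact: le_trans hx.
have ee : e * e <= 100^-1 * e by rewrite ler_wpM2r.
have eee : e * e * e <= 100^-1 * e * e by rewrite ler_wpM2r.
have -> : x * y * z + 2 * (u * v * w) - x * w * w - y * v * v - z * u * u - 1 =
  (x - 1) * (y - 1) * (z - 1) + (x - 1) * (y - 1) + (x - 1) * (z - 1) + (y - 1) * (z - 1)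
  + (x - 1) + (y - 1) + (z - 1) + 2 * (u * v * w) - (x - 1) * (w * w) - w * w
  - (y - 1) * (v * v) - v * v - (z - 1) * (u * u) - u * u by ring.
have xy := normrM_le hx hy; have xz := normrM_le hx hz; have yz := normrM_le hy hz.
have xyz := normrM_le xy hz.
have ww := normrM_le hw hw; have vv := normrM_le hv hv; have uu := normrM_le hu hu.
have xww := normrM_le hx ww; have yvv := normrM_le hy vv; have zuu := normrM_le hz uu.
have uvw := normrM_le (normrM_le hu hv) hw.
move: hx hy hz xy xz yz xyz ww vv uu xww yvv zuu uvw.
by rewrite !ler_norml; lra.
Qed.

(* With C = cof h one has (det h)^2 = det C and (det h) h = cof C, so h is
   recovered from C up to the sign of det h. *)
Lemma cofactor_near1 (h11 h12 h13 h22 h23 h33 e : R) : e <= 100^-1 ->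
  `|h22 * h33 - h23 * h23 - 1| <= e -> `|h11 * h33 - h13 * h13 - 1| <= e ->
  `|h11 * h22 - h12 * h12 - 1| <= e -> `|h13 * h23 - h12 * h33| <= e ->
  `|h12 * h23 - h13 * h22| <= e -> `|h12 * h13 - h11 * h23| <= e ->
  let d := h11 * h22 * h33 + 2 * (h12 * h13 * h23) - h11 * h23 * h23
           - h22 * h13 * h13 - h33 * h12 * h12 in
  [/\ `|d * d - 1| <= 5 * e,
   [/\ `|d * h11 - 1| <= 3 * e, `|d * h22 - 1| <= 3 * e & `|d * h33 - 1| <= 3 * e] &
   [/\ `|d * h12| <= 3 * e, `|d * h13| <= 3 * e & `|d * h23| <= 3 * e]].
Proof.
move=> e1 h1 h2 h3 h4 h5 h6 d; split.
- have := near1_det e1 h1 h2 h3 h4 h5 h6.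
  by congr (`|_| <= _); rewrite /d; ring.
- split.
  + by have := near1_minor e1 h2 h3 h6 h6; congr (`|_| <= _); rewrite /d; ring.
  + by have := near1_minor e1 h1 h3 h5 h5; congr (`|_| <= _); rewrite /d; ring.
  + by have := near1_minor e1 h1 h2 h4 h4; congr (`|_| <= _); rewrite /d; ring.
- split.
  + by have := near0_minor e1 h3 h5 h6 h4; congr (`|_| <= _); rewrite /d; ring.
  + by have := near0_minor e1 h2 h4 h6 h5; congr (`|_| <= _); rewrite /d; ring.
  + by have := near0_minor e1 h1 h4 h5 h6; congr (`|_| <= _); rewrite /d; ring.
Qed.

(* The derivative of cof h in the direction k determines k: by homogeneity
   tr (h (cof h)') = 2 (det h)', and (det h) k = (cof (cof h))' - (det h)' h. *)
Lemma cofactor_derivative_le (h11 h12 h13 h22 h23 h33 k11 k12 k13 k22 k23 k33 p : R) :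
  let C11 := h22 * h33 - h23 * h23 in let C22 := h11 * h33 - h13 * h13 in
  let C33 := h11 * h22 - h12 * h12 in let C12 := h13 * h23 - h12 * h33 in
  let C13 := h12 * h23 - h13 * h22 in let C23 := h12 * h13 - h11 * h23 in
  let d := h11 * h22 * h33 + 2 * (h12 * h13 * h23) - h11 * h23 * h23
           - h22 * h13 * h13 - h33 * h12 * h12 in
  [/\ `|C11| <= 2, `|C22| <= 2 & `|C33| <= 2] -> [/\ `|C12| <= 2, `|C13| <= 2 & `|C23| <= 2] ->
  [/\ `|h11| <= 2, `|h22| <= 2 & `|h33| <= 2] -> [/\ `|h12| <= 2, `|h13| <= 2 & `|h23| <= 2] ->
  4^-1 <= d * d ->
  [/\ `|k22 * h33 + h22 * k33 - k23 * h23 - h23 * k23| <= p,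
      `|k11 * h33 + h11 * k33 - k13 * h13 - h13 * k13| <= p
    & `|k11 * h22 + h11 * k22 - k12 * h12 - h12 * k12| <= p] ->
  [/\ `|k13 * h23 + h13 * k23 - k12 * h33 - h12 * k33| <= p,
      `|k12 * h23 + h12 * k23 - k13 * h22 - h13 * k22| <= p
    & `|k12 * h13 + h12 * k13 - k11 * h23 - h11 * k23| <= p] ->
  [/\ `|k11| <= 52 * p, `|k22| <= 52 * p & `|k33| <= 52 * p] /\
  [/\ `|k12| <= 52 * p, `|k13| <= 52 * p & `|k23| <= 52 * p].
Proof.
move=> C11 C22 C33 C12 C13 C23 d [c11 c22 c33] [c12 c13 c23] [b11 b22 b33] [b12 b13 b23] d2.
set D11 := _ - h23 * k23; set D22 := _ - h13 * k13; set D33 := _ - h12 * k12.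
set D12 := _ - h12 * k33; set D13 := _ - h13 * k22; set D23 := _ - h11 * k23.
move=> [e11 e22 e33] [e12 e13 e23].
(* [d'] is the derivative of the determinant; with entries of [h] at most 2, half of (3 + 6) * 2 * p
   gives the bound 9 * p. *)
pose d' := 2^-1 * (h11 * D11 + h22 * D22 + h33 * D33 + 2 * (h12 * D12) + 2 * (h13 * D13)
  + 2 * (h23 * D23)).
have d'p : `|d'| <= 9 * p.
  have := normrM_le b11 e11; have := normrM_le b22 e22; have := normrM_le b33 e33.
  have := normrM_le b12 e12; have := normrM_le b13 e13; have := normrM_le b23 e23.
  by rewrite /d' !ler_norml; lra.
(* The common shape of the six entries of [d * k]: four products of size 2 * p and one of size 9 * p
   * 2 add up to 26 * p, and [|d| >= 2^-1] doubles this. *)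
have k_le (x y z x' y' z' u k : R) :
    `|x| <= 2 -> `|y| <= 2 -> `|z| <= 2 -> `|u| <= 2 -> `|x'| <= p -> `|y'| <= p ->
    `|z'| <= p -> forall w w', `|w| <= 2 -> `|w'| <= p ->
    d * k = x' * y + x * y' - z' * w - z * w' - d' * u -> `|k| <= 52 * p.
  move=> hx hy hz hu hx' hy' hz' w w' hw hw' dk.
  have : `|d * k| <= 26 * p.
    have := normrM_le hx' hy; have := normrM_le hx hy'; have := normrM_le hz' hw.
    have := normrM_le hz hw'; have := normrM_le d'p hu.
    by rewrite dk !ler_norml; lra.
  have d12 : 2^-1 <= `|d|.
    rewrite -(@ler_pXn2r _ 2) ?nnegrE ?invr_ge0 // -normrX ger0_norm ?sqr_ge0 //.
    by rewrite expr2; move: d2; rewrite expr2; lra.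
  have := ler_wpM2r (normr_ge0 k) d12; rewrite -normrM; lra.
split; split.
- by apply: (k_le _ _ _ _ _ _ _ _ c22 c33 c23 b11 e22 e33 e23 _ _ c23 e23);
    rewrite /C22 /C33 /C23 /d' /D22 /D33 /D23 /D11 /D12 /D13 /d; field.
- by apply: (k_le _ _ _ _ _ _ _ _ c11 c33 c13 b22 e11 e33 e13 _ _ c13 e13);
    rewrite /C11 /C33 /C13 /d' /D22 /D33 /D23 /D11 /D12 /D13 /d; field.
- by apply: (k_le _ _ _ _ _ _ _ _ c11 c22 c12 b33 e11 e22 e12 _ _ c12 e12);
    rewrite /C22 /C11 /C12 /d' /D22 /D33 /D23 /D11 /D12 /D13 /d; field.
- by apply: (k_le _ _ _ _ _ _ _ _ c13 c23 c12 b12 e13 e23 e12 _ _ c33 e33);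
    rewrite /C13 /C33 /C23 /C12 /d' /D22 /D33 /D23 /D11 /D12 /D13 /d; field.
- by apply: (k_le _ _ _ _ _ _ _ _ c12 c23 c13 b13 e12 e23 e13 _ _ c22 e22);
    rewrite /C22 /C12 /C23 /C13 /d' /D22 /D33 /D23 /D11 /D12 /D13 /d; field.
- by apply: (k_le _ _ _ _ _ _ _ _ c12 c13 c23 b23 e12 e13 e23 _ _ c11 e11);
    rewrite /C11 /C12 /C13 /C23 /d' /D22 /D33 /D23 /D11 /D12 /D13 /d; field.
Qed.

End NearlyRoundHypersurface.

(** * Nearly orthonormal families and normal components *)

Section NearlyOrthonormal.
Variable R : realType.

(** The Gram matrix differs from the identity by a form of norm at most [eta * #|I|], hence is at
    least half the identity. *)
Lemma near_gram_ge (I : finType) (w : I -> E4 R) (eta : R) :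
  (forall i j, `|dot (w i) (w j) - (i == j)%:R| <= eta) -> eta * #|I|%:R <= 2^-1 ->
  forall q : I -> R,
  \sum_i q i ^+ 2 <= 2 * dot (\sum_i q i *: w i) (\sum_i q i *: w i).
Proof.
move=> hw eta1 q.
have -> : dot (\sum_i q i *: w i) (\sum_i q i *: w i) =
   \sum_i q i ^+ 2 + \sum_i \sum_j q i * q j * (dot (w i) (w j) - (i == j)%:R).
  rewrite dot_suml -big_split; apply: eq_bigr => i _ /=.
  rewrite dot_sumr.
  under [X in _ + X]eq_bigr do rewrite mulrBr.
  have -> : q i ^+ 2 = \sum_j q i * q j * (i == j)%:R.
    rewrite (bigD1 i) //= eqxx mulr1 big1 ?addr0 ?expr2 // => j ji.
    by rewrite eq_sym (negbTE ji) mulr0.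
  rewrite sumrB addrC subrK; apply: eq_bigr => j _.
  by rewrite dotZl dotZr mulrA.
have : `|\sum_i \sum_j q i * q j * (dot (w i) (w j) - (i == j)%:R)| <=
    \sum_i \sum_j 2^-1 * eta * (q i ^+ 2 + q j ^+ 2).
  apply: le_trans (ler_norm_sum _ _ _) _; apply: ler_sum => i _.
  apply: le_trans (ler_norm_sum _ _ _) _; apply: ler_sum => j _.
  rewrite normrM mulrAC.
  have : `|q i * q j| <= 2^-1 * (q i ^+ 2 + q j ^+ 2).
    rewrite ler_norml; have := sqr_ge0 (q i + q j); have := sqr_ge0 (q i - q j).
    by rewrite !expr2; lra.
  by move=> qq; apply: ler_pM.
have -> : \sum_i \sum_j 2^-1 * eta * (q i ^+ 2 + q j ^+ 2) =
   eta * #|I|%:R * \sum_i q i ^+ 2.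
  under eq_bigr do rewrite -mulr_sumr big_split /= sumr_const.
  rewrite -mulr_sumr big_split /= sumr_const.
  under eq_bigr do rewrite -mulr_natr.
  by rewrite -mulr_suml -[X in _ + X]mulr_natr /=; field.
have Q0 : 0 <= \sum_i q i ^+ 2 by apply: sumr_ge0 => i _; exact: sqr_ge0.
have := ler_wpM2r Q0 eta1.
by rewrite ler_norml; lra.
Qed.

(** The bound 8^-1 is the threshold of [near_gram_ge] for four vectors; it makes them independent,
    hence a basis. *)
Lemma near_orthonormal_span (w : 'I_4 -> E4 R) (eta : R) :
  (forall i j, `|dot (w i) (w j) - (i == j)%:R| <= eta) -> eta <= 8^-1 ->
  forall v, exists q : 'I_4 -> R, v = \sum_i q i *: w i.
Proof.
move=> hw eta1 v; pose B : 'M[R]_4 := \matrix_i w i.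
have cB (c : E4 R) : c *m B = \sum_i c 0 i *: w i.
  by rewrite mulmx_sum_row; apply: eq_bigr => i _; rewrite rowK.
have Bfree : row_free B.
  apply: inj_row_free => c /eqP; rewrite cB => /eqP c0.
  have := near_gram_ge hw; rewrite card_ord => /(_ _ (fun i => c 0 i)).
  rewrite c0 dot0l mulr0 => cc; apply/rowP => i; rewrite mxE; apply/eqP.
  rewrite -sqrf_eq0; apply/eqP.
  have C0 : \sum_i c 0 i ^+ 2 = 0.
    apply/eqP; rewrite eq_le cc /=; last by lra.
    by apply: sumr_ge0 => j _; exact: sqr_ge0.
  by apply: (psumr_eq0P _ C0) => // j _; exact: sqr_ge0.
rewrite row_free_unit in Bfree.
by exists (fun i => (v *m invmx B) 0 i); rewrite -cB mulmxKV.
Qed.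

(** Three vectors have rank at most 3, so some nonzero vector of R^4 is orthogonal to all of
    them. *)
Lemma exists_unit_normal (a : 'I_3 -> E4 R) :
  exists n, dot n n = 1 /\ forall i, dot n (a i) = 0.
Proof.
pose A : 'M[R]_(3, 4) := \matrix_i a i.
have : kermx A^T != 0.
  rewrite -mxrank_eq0 mxrank_ker mxrank_tr -lt0n subn_gt0.
  exact: leq_ltn_trans (rank_leq_row A) _.
move=> /rowV0Pn [u /sub_kermxP uA u0].
have uu : 0 < dot u u by rewrite lt_neqAle dot_ge0 eq_sym dot_eq0 u0.
exists ((Num.sqrt (dot u u))^-1 *: u); split.
  rewrite dotZl dotZr mulrA -invfM -expr2 sqr_sqrtr ?ltW // mulVf //.
  by rewrite gt_eqF.
move=> i; rewrite dotZl (_ : dot u (a i) = 0) ?mulr0 //.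
have /rowP/(_ i) := uA; rewrite !mxE => <-.
by apply: eq_bigr => j _; rewrite !mxE.
Qed.

(* Parseval up to second order: the tangential parts of v and w contribute
   quadratically in the size of their products with the frame. *)
Lemma dot_normal_component (a : 'I_3 -> E4 R) (n : E4 R) (eta : R) :
  (forall i j, `|dot (a i) (a j) - (i == j)%:R| <= eta) -> eta <= 8^-1 ->
  dot n n = 1 -> (forall i, dot n (a i) = 0) ->
  forall v w kappa, (forall i, `|dot v (a i)| <= kappa) ->
  (forall i, `|dot w (a i)| <= kappa) ->
  `|dot v w - dot v n * dot w n| <= 6 * (kappa * kappa).
Proof.
move=> ha eta1 nn na.
have eta0 : 0 <= eta by exact: le_trans (ha ord0 ord0).
(* The frame [n], [a 0], [a 1], [a 2] indexed by ['I_4]; [T v] below is the part of [v] orthogonal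
   to [n]. *)
pose f i := oapp a n (unlift ord0 i).
have f0 : f ord0 = n by rewrite /f unlift_none.
have fS i : f (lift ord0 i) = a i by rewrite /f liftK.
have hf i j : `|dot (f i) (f j) - (i == j)%:R| <= eta.
  rewrite /f; case: (unliftP ord0 i) => [i'|] ->; case: (unliftP ord0 j) => [j'|] -> /=.
  - by rewrite (inj_eq lift_inj); exact: ha.
  - by rewrite dotC na subrr normr0.
  - by rewrite na subrr normr0.
  - by rewrite nn subrr normr0.
pose T v := v - dot v n *: n.
have Tn v : dot (T v) n = 0 by rewrite dotBl dotZl nn mulr1 subrr.
have Ta v i : dot (T v) (a i) = dot v (a i) by rewrite dotBl dotZl na mulr0 subr0.
(* With [q] the coefficients of [T v], |T v|^2 = sum q_i <v, a_i> <= (sum q_i^2) / 4 + 3 kappa^2,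
   and sum q_i^2 <= 2 |T v|^2. Half of |T v|^2 is absorbed on the left, leaving the constant 6. *)
have Tle v kappa : (forall i, `|dot v (a i)| <= kappa) -> dot (T v) (T v) <= 6 * (kappa * kappa).
  move=> hv.
  have [q vq] := near_orthonormal_span hf eta1 v.
  have Tq : T v = \sum_i q (lift ord0 i) *: a i.
    have vn : dot v n = q ord0.
      rewrite {1}vq big_ord_recl dotDl f0 dotZl nn mulr1 dot_suml big1 ?addr0 //.
      by move=> i _; rewrite dotZl fS dotC na mulr0.
    rewrite /T vn {1}vq big_ord_recl f0 addrAC subrr add0r.
    by apply: eq_bigr => i _; rewrite fS.
  have ge := near_gram_ge ha; rewrite card_ord in ge.
  have {}ge := ge _ (fun i => q (lift ord0 i)); rewrite -Tq in ge.
  have TT : dot (T v) (T v) = \sum_i q (lift ord0 i) * dot v (a i).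
    rewrite {1}Tq dot_suml; apply: eq_bigr => i _.
    by rewrite dotZl [dot (a i) _]dotC Ta.
  have qp i : q (lift ord0 i) * dot v (a i) <= 4^-1 * q (lift ord0 i) ^+ 2 + kappa * kappa.
    have k2 : dot v (a i) * dot v (a i) <= kappa * kappa.
      rewrite -[leLHS]ger0_norm -?expr2 ?sqr_ge0 // expr2.
      by have := normrM_le (hv i) (hv i); rewrite expr2.
    have := sqr_ge0 (2^-1 * q (lift ord0 i) - dot v (a i)); rewrite !expr2; lra.
  have : \sum_i q (lift ord0 i) * dot v (a i) <=
      \sum_(i < 3) (4^-1 * q (lift ord0 i) ^+ 2 + kappa * kappa) by apply: ler_sum.
  rewrite -TT big_split /= -mulr_sumr sumr_const card_ord -mulr_natr.
  have := ge _; lra.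
move=> v w kappa hv hw.
have -> : dot v w - dot v n * dot w n = dot (T v) (T w).
  rewrite /T !(dotBl, dotBr, dotZl, dotZr) nn [dot n w]dotC.
  by ring.
by have := dot_young (T v) (T w); have := Tle _ _ hv; have := Tle _ _ hw; lra.
Qed.

End NearlyOrthonormal.

(** * The quadratic estimate for the derivatives of an immersion at one point *)

Section Obstruction.
Variable R : realType.

Local Notation o1 := (@Ordinal 3 0 isT).
Local Notation o2 := (@Ordinal 3 1 isT).
Local Notation o3 := (@Ordinal 3 2 isT).

Lemma ord3_ind (P : 'I_3 -> Prop) : P o1 -> P o2 -> P o3 -> forall i, P i.
Proof.
move=> P1 P2 P3 [[|[|[|//]]] hi].
- by rewrite (_ : Ordinal hi = o1) //; exact: val_inj.
- by rewrite (_ : Ordinal hi = o2) //; exact: val_inj.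
- by rewrite (_ : Ordinal hi = o3) //; exact: val_inj.
Qed.

(** Used to divide by the determinant of [h], whose square is near 1 but whose sign is unknown. *)
Lemma normr_div_le (d x y : R) : 4^-1 <= d * d -> `|d * x| <= y -> `|x| <= 2 * y.
Proof.
move=> d2.
have d12 : 2^-1 <= `|d|.
  rewrite -(@ler_pXn2r _ 2) ?nnegrE ?invr_ge0 // -normrX ger0_norm ?sqr_ge0 //.
  by rewrite expr2; move: d2; rewrite expr2; lra.
by have := ler_wpM2r (normr_ge0 x) d12; rewrite normrM; lra.
Qed.

(* a, b, c are the first, second and third derivatives at a point of an
   immersion of a hypersurface, in coordinates whose metric agrees up to eta,
   with three derivatives, with the graph coordinates of the round sphere. For
   the sphere itself c = 0 and the normal part of b is the identity, which
   makes the expression below quadratically small. *)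
Lemma obstruction_small (a : 'I_3 -> E4 R) (b : 'I_3 -> 'I_3 -> E4 R)
    (c : 'I_3 -> 'I_3 -> 'I_3 -> E4 R) (eta : R) :
  eta <= (1000 * 1000)^-1 ->
  (forall i j, b i j = b j i) ->
  (forall i j k, c i j k = c j i k) -> (forall i j k, c i j k = c i k j) ->
  (forall i j, `|dot (a i) (a j) - (i == j)%:R| <= eta) ->
  (forall i j k, `|dot (b i j) (a k)| <= 2 * eta) ->
  (forall i j k l, `|dot (b i j) (b l k) - dot (b i l) (b j k)
     - ((i == j)%:R * (l == k)%:R - (i == l)%:R * (j == k)%:R)| <= 2 * eta) ->
  (forall m i j p, `|dot (c m i j) (a p) + dot (b i j) (b m p)
     - (i == j)%:R * (m == p)%:R| <= 2 * eta) ->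
  (forall m i j k l, `|dot (c m i j) (b l k) + dot (b i j) (c m l k)
     - dot (c m i l) (b j k) - dot (b i l) (c m j k)| <= 2 * eta) ->
  `|(dot (c o3 o1 o2) (b o3 o3) + dot (b o1 o2) (c o3 o3 o3)
      - dot (c o3 o1 o3) (b o2 o3) - dot (b o1 o3) (c o3 o2 o3))
    - (dot (c o1 o2 o3) (b o1 o1) + dot (b o2 o3) (c o1 o1 o1)
      - dot (c o1 o2 o1) (b o3 o1) - dot (b o2 o1) (c o1 o3 o1))|
    <= 1200 * 1000 * (eta * eta).
Proof.
move=> eta1 bC cC12 cC23 ha hb hg hc hg'.
have eta0 : 0 <= eta by exact: le_trans (ha o1 o1).
have ee : eta * eta <= (1000 * 1000)^-1 * eta by rewrite ler_wpM2r.
have eta8 : eta <= 8^-1 by apply: le_trans eta1 _; lra.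
have [n [nn na]] := exists_unit_normal a.
have normal_part := dot_normal_component ha eta8 nn na.
pose H i j := dot (b i j) n.
have HC i j : H i j = H j i by rewrite /H bC.
(* [normal_part] with kappa = 2 * eta. *)
have bb i j k l : `|dot (b i j) (b k l) - H i j * H k l| <= 24 * (eta * eta).
  have := normal_part _ _ _ (hb i j) (hb k l).
  by congr (_ <= _); ring.
(* The error 2 * eta of the Gauss equation plus two errors [bb]. *)
pose e := 3 * eta.
have e1 : e <= 100^-1 by rewrite /e; lra.
have gauss i j k l : `|H i j * H l k - H i l * H j k
    - ((i == j)%:R * (l == k)%:R - (i == l)%:R * (j == k)%:R)| <= e.
  have := hg i j k l; have := bb i j l k; have := bb i l j k.
  by rewrite /e !ler_norml; lra.
have := gauss o2 o2 o3 o3; have := gauss o1 o1 o3 o3; have := gauss o1 o1 o2 o2.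
have := gauss o1 o3 o3 o2; have := gauss o1 o2 o2 o3; have := gauss o2 o1 o1 o3.
rewrite /= !(mulr0, mul0r, mulr1, subr0, subrr).
rewrite (HC o3 o2) (HC o2 o1) => g23 g13 g12 g33 g22 g11.
rewrite (HC o3 o1) (mulrC (H o2 o3)) in g23.
have := cofactor_near1 e1 g11 g22 g33 g12 g13 g23.
set d := _ - _ * H o1 o2 => -[dd [x11 x22 x33] [x12 x13 x23]].
have d14 : 4^-1 <= d * d by move: dd; rewrite ler_norml; clear -e1; lra.
have X i j : `|d * H i j - (i == j)%:R| <= 3 * e.
  by elim/ord3_ind: i; elim/ord3_ind: j; rewrite /= ?subr0 // HC.
have e0 : 0 <= e by rewrite mulr_ge0.
(* A product of two entries does not change under [H] to [- H], so it can be compared with the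
   identity without deciding the sign. The two divisions by [d] account for the factor 4. *)
have HH i j m p : `|H i j * H m p - (i == j)%:R * (m == p)%:R| <= 144 * eta.
  have -> : 144 * eta = 2 * (2 * (12 * e)) by rewrite /e; ring.
  apply: (normr_div_le d14); apply: (normr_div_le d14).
  have -> : d * (d * (H i j * H m p - (i == j)%:R * (m == p)%:R)) =
    (d * H i j - (i == j)%:R) * (d * H m p - (m == p)%:R)
    + (d * H i j - (i == j)%:R) * (m == p)%:R + (i == j)%:R * (d * H m p - (m == p)%:R)
    - (d * d - 1) * ((i == j)%:R * (m == p)%:R) by ring.
  have := normrM_le (X i j) (X m p); have := ler_wpM2r e0 e1.
  have := X i j; have := X m p; move: dd.
  by case: (i == j); case: (m == p); rewrite /= ?mulr1n ?mulr0n !ler_norml; clear -e0; lra.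
(* By [hc] the tangential part of a third derivative is the deviation of <b_ij, b_mp> from its round
   value, up to 2 * eta; 150 leaves room for the quadratic error. *)
have ct m i j p : `|dot (c m i j) (a p)| <= 150 * eta.
  have := hc m i j p; have := HH i j m p; have := bb i j m p.
  by rewrite !ler_norml; clear -eta0 eta1 ee; lra.
have bt i j k : `|dot (b i j) (a k)| <= 150 * eta.
  by have := hb i j k; clear -eta0; lra.
pose K m i j := dot (c m i j) n.
(* 6 * 150^2 = 135 * 1000; the bound on [b] was relaxed to 150 * eta so that both vectors share one
   kappa. *)
have cb m i j k l : `|dot (c m i j) (b k l) - K m i j * H k l| <= 135 * 1000 * (eta * eta).
  have := normal_part _ _ _ (ct m i j) (bt k l).
  by move=> h; apply: le_trans h _; have := mulr_ge0 eta0 eta0; clear; lra.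
have K12 m i j : K m i j = K i m j by rewrite /K cC12.
have K23 m i j : K m i j = K m j i by rewrite /K cC23.
(* Four errors [cb] must fit into one [eta], which holds because [eta] is at most 10^-6. *)
have dgauss m i j k l : `|K m i j * H l k + H i j * K m l k
    - K m i l * H j k - H i l * K m j k| <= 3 * eta.
  have := hg' m i j k l; have := cb m i j l k; have := cb m i l j k.
  have := cb m l k i j; have := cb m j k i l.
  rewrite ![dot (b _ _) (c _ _ _)]dotC.
  by rewrite !ler_norml; clear -eta0 eta1 ee; lra.
have h2 i j : `|H i j| <= 2.
  have -> : 2 = 2 * 1 :> R by ring.
  (* The factor 2 / 3 is slack: [d * H i j] may slightly exceed 1, and [normr_div_le] with [d]
     itself would miss the bound 2. *)
  have d23 : 4^-1 <= (2 / 3 * d) * (2 / 3 * d) by move: dd; rewrite ler_norml; clear -e1; lra.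
  apply: (normr_div_le d23); have := X i j; rewrite -mulrA.
  by case: (i == j); rewrite /= ?mulr1n ?mulr0n !ler_norml; clear -e1; lra.
have Kle m i j : `|K m i j| <= 52 * (3 * eta).
  have := dgauss m o2 o2 o3 o3; have := dgauss m o1 o1 o3 o3; have := dgauss m o1 o1 o2 o2.
  have := dgauss m o1 o3 o3 o2; have := dgauss m o1 o2 o2 o3; have := dgauss m o2 o1 o1 o3.
  rewrite !(HC o3 o2) !(HC o2 o1) !(HC o3 o1) !(K23 m o3 o2) !(K23 m o2 o1) !(K23 m o3 o1).
  move=> k23 k13 k12 k33 k22 k11.
  have {}k23 : `|K m o1 o2 * H o1 o3 + H o1 o2 * K m o1 o3 - K m o1 o1 * H o2 o3
     - H o1 o1 * K m o2 o3| <= 3 * eta by move: k23; congr (`|_| <= _); ring.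
  have near2 (x : R) : `|x - 1| <= e -> `|x| <= 2.
    by rewrite !ler_norml; clear -e1; lra.
  have small2 (x : R) : `|x| <= e -> `|x| <= 2 by clear -e1; lra.
  have [[K11 K22 K33] [K12' K13 K23']] := cofactor_derivative_le
    (And3 (near2 _ g11) (near2 _ g22) (near2 _ g33))
    (And3 (small2 _ g12) (small2 _ g13) (small2 _ g23))
    (And3 (h2 o1 o1) (h2 o2 o2) (h2 o3 o3)) (And3 (h2 o1 o2) (h2 o1 o3) (h2 o2 o3))
    d14 (And3 k11 k22 k33) (And3 k12 k13 k23).
  by elim/ord3_ind: i; elim/ord3_ind: j; rewrite // K23.
have H0 i j : i != j -> `|H i j| <= 18 * eta.
  move=> /negbTE ij; have -> : 18 * eta = 2 * (3 * e) by rewrite /e; ring.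
  by apply: (normr_div_le d14); have := X i j; rewrite ij subr0.
have H1 : `|H o3 o3 - H o1 o1| <= 36 * eta.
  have -> : 36 * eta = 2 * (6 * e) by rewrite /e; ring.
  apply: (normr_div_le d14); have := X o3 o3; have := X o1 o1.
  by rewrite /= mulrBr !ler_norml; clear; lra.
have KH m i j k l : k != l -> `|K m i j * H k l| <= 52 * (3 * eta) * (18 * eta).
  by move=> kl; exact: normrM_le (Kle _ _ _) (H0 _ _ kl).
rewrite ![dot (b _ _) (c _ _ _)]dotC.
(* The leading terms combine to [K o1 o2 o3 * (H o3 o3 - H o1 o1)]. Eight errors [cb] cost 1080 *
   1000 * eta^2 and the seven products of small factors less than 23 * 1000 * eta^2, within the
   stated 1200 * 1000. *)
have := normrM_le (Kle o1 o2 o3) H1.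
have := cb o3 o1 o2 o3 o3; have := cb o1 o2 o3 o1 o1.
rewrite (K12 o3) (K23 o1 o3).
have := KH o3 o3 o3 o1 o2 isT; have := cb o3 o3 o3 o1 o2.
have := KH o3 o1 o3 o2 o3 isT; have := cb o3 o1 o3 o2 o3.
have := KH o3 o2 o3 o1 o3 isT; have := cb o3 o2 o3 o1 o3.
have := KH o1 o1 o1 o2 o3 isT; have := cb o1 o1 o1 o2 o3.
have := KH o1 o2 o1 o3 o1 isT; have := cb o1 o2 o1 o3 o1.
have := KH o1 o3 o1 o2 o1 isT; have := cb o1 o3 o1 o2 o1.
by rewrite !ler_norml; clear -eta0; have := mulr_ge0 eta0 eta0; lra.
Qed.

End Obstruction.

(* Three-dimensional charts are functions on R^4 that ignore the coordinate of
   index 0. *)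
HB.lock Definition dpd (R : realType) (s : seq 'I_3) (f : E4 R -> R^o) : E4 R -> R^o :=
  pd [seq lift ord0 i | i <- s] f.

(** * The Gauss equation for the jets of an immersion *)

Section InducedMetric.
Variable R : realType.
Implicit Types (x y : E4 R) (s t : seq 'I_3) (g h : E4 R -> R^o).

Local Notation o1 := (@Ordinal 3 0 isT).
Local Notation o2 := (@Ordinal 3 1 isT).
Local Notation o3 := (@Ordinal 3 2 isT).

Definition jet (f : 'I_4 -> E4 R -> R^o) (s : seq 'I_3) x : E4 R :=
  \row_al dpd s (f al) x.

(* Twice the component d_3 K_1233 - d_1 K_2311 of the linearized Cotton tensor,
   where 2 K_ijkl = d_l d_i gam_jk - d_l d_k gam_ij - d_j d_i gam_lk + d_j d_k gam_il. *)
Definition obstruction (gam : 'I_3 -> 'I_3 -> E4 R -> R^o) x : R :=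
  (dpd [:: o3; o3; o1] (gam o2 o3) x - dpd [:: o3; o3; o3] (gam o1 o2) x
    - dpd [:: o3; o2; o1] (gam o3 o3) x + dpd [:: o3; o2; o3] (gam o1 o3) x)
  - (dpd [:: o1; o1; o2] (gam o3 o1) x - dpd [:: o1; o1; o1] (gam o2 o3) x
    - dpd [:: o1; o3; o2] (gam o1 o1) x + dpd [:: o1; o3; o1] (gam o2 o1) x).

Variables (U : set (E4 R)) (oU : open U) (f : 'I_4 -> E4 R -> R^o).
Hypothesis sf : forall al, smooth_on U (f al).

Local Notation v := (jet f).

Lemma smooth_dpd s g : smooth_on U g -> smooth_on U (dpd s g).
Proof. by rewrite dpd.unlock; exact: smooth_pd. Qed.

Lemma dpdC i j s g x : smooth_on U g -> U x -> dpd (i :: j :: s) g x = dpd (j :: i :: s) g x.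
Proof.
move=> sg Ux; rewrite dpd.unlock.
exact: (pdC oU (lift ord0 i) (lift ord0 j) (smooth_pd [seq lift ord0 a | a <- s] sg) Ux).
Qed.

Lemma dpd_cons k s g : dpd (k :: s) g = dpd [:: k] (dpd s g).
Proof. by rewrite dpd.unlock. Qed.

Lemma dpd_eq_on s g h x : (forall y, U y -> g y = h y) -> U x -> dpd s g x = dpd s h x.
Proof. by move=> gh Ux; rewrite dpd.unlock; exact: pd_eq_on gh _ Ux. Qed.

Lemma dpdD s g h x : smooth_on U g -> smooth_on U h -> U x ->
  dpd s (fun y => g y + h y) x = dpd s g x + dpd s h x.
Proof. by move=> sg sh Ux; rewrite dpd.unlock (pdD oU _ sg sh Ux). Qed.

Lemma dpdB s g h x : smooth_on U g -> smooth_on U h -> U x ->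
  dpd s (fun y => g y - h y) x = dpd s g x - dpd s h x.
Proof. by move=> sg sh Ux; rewrite dpd.unlock (pdB oU _ sg sh Ux). Qed.

Lemma dpdZ s (c : R) g x : smooth_on U g -> U x ->
  dpd s (fun y => c * g y) x = c * dpd s g x.
Proof. by move=> sg Ux; rewrite dpd.unlock (pdZ oU _ _ sg Ux). Qed.

Lemma dpd_sum (I : Type) (r : seq I) (F : I -> E4 R -> R^o) s x :
  (forall i, smooth_on U (F i)) -> U x ->
  dpd s (fun y => \sum_(i <- r) F i y) x = \sum_(i <- r) dpd s (F i) x.
Proof. by move=> sF Ux; rewrite dpd.unlock (pd_sum oU _ _ sF Ux). Qed.

Lemma dpd1M k g h x : smooth_on U g -> smooth_on U h -> U x ->
  dpd [:: k] (fun y => g y * h y) x = dpd [:: k] g x * h x + g x * dpd [:: k] h x.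
Proof. by move=> sg sh Ux; rewrite dpd.unlock (pd1M _ sg sh Ux). Qed.

Lemma jetE s x al : v s x 0 al = dpd s (f al) x.
Proof. by rewrite mxE. Qed.

Lemma jet_dotE s t :
  (fun y => dot (v s y) (v t y)) = (fun y => \sum_al dpd s (f al) y * dpd t (f al) y).
Proof. by apply/funext => y; apply: eq_bigr => al _; rewrite !jetE. Qed.

Lemma smooth_jet_mul s t al : smooth_on U (fun y => dpd s (f al) y * dpd t (f al) y).
Proof. by apply: (smoothM oU); exact: smooth_dpd. Qed.

Lemma dpd_jet_dot k s t x : U x ->
  dpd [:: k] (fun y => dot (v s y) (v t y)) x =
  dot (v (k :: s) x) (v t x) + dot (v s x) (v (k :: t) x).
Proof.
move=> Ux; rewrite jet_dotE (dpd_sum _ _ (smooth_jet_mul s t) Ux).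
rewrite -big_split; apply: eq_bigr => al _; rewrite !jetE (dpd_cons k s) (dpd_cons k t).
exact: (dpd1M k (smooth_dpd s (sf al)) (smooth_dpd t (sf al)) Ux).
Qed.

Lemma jet_swap i j s x : U x -> v (i :: j :: s) x = v (j :: i :: s) x.
Proof.
by move=> Ux; apply/rowP => al; rewrite [LHS]jetE [RHS]jetE; exact: (dpdC i j s (sf al) Ux).
Qed.

Lemma jet_swap3 k i j x : U x -> v [:: k; i; j] x = v [:: k; j; i] x.
Proof.
move=> Ux; apply/rowP => al; rewrite [LHS]jetE [RHS]jetE.
rewrite (dpd_cons k [:: i; j]) (dpd_cons k [:: j; i]).
apply: (dpd_eq_on [:: k] _ Ux) => y Uy.
exact: (dpdC i j [::] (sf al) Uy).
Qed.

Variable gam : 'I_3 -> 'I_3 -> E4 R -> R^o.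
Hypothesis sgam : forall i j, smooth_on U (gam i j).
Hypothesis gamE : forall i j x, U x -> gam i j x = dot (v [:: i] x) (v [:: j] x).

(** The Christoffel symbols of the first kind, by the usual permutation of the derivatives of <d_i
    f, d_j f>. *)
Lemma first_kind_symbol i j k x : U x ->
  dot (v [:: i; j] x) (v [:: k] x) =
  2^-1 * (dpd [:: i] (gam j k) x + dpd [:: j] (gam i k) x - dpd [:: k] (gam i j) x).
Proof.
move=> Ux.
have dgam a b c : dpd [:: a] (gam b c) x =
    dot (v [:: a; b] x) (v [:: c] x) + dot (v [:: a; c] x) (v [:: b] x).
  rewrite [X in _ + X]dotC -(dpd_jet_dot _ _ _ Ux).
  by apply: (dpd_eq_on [:: a] _ Ux) => y; exact: gamE.
rewrite !dgam (jet_swap j i _ Ux) (jet_swap k i _ Ux) (jet_swap k j _ Ux).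
have cancel_halves (A B C : R) : A = 2^-1 * (A + B + (A + C) - (B + C)) by field.
exact: cancel_halves.
Qed.

Lemma first_kind_symbol_derivative l i j k x : U x ->
  dot (v [:: l; i; j] x) (v [:: k] x) + dot (v [:: i; j] x) (v [:: l; k] x) =
  2^-1 * (dpd [:: l; i] (gam j k) x + dpd [:: l; j] (gam i k) x
          - dpd [:: l; k] (gam i j) x).
Proof.
move=> Ux; rewrite -dpd_jet_dot //.
rewrite (dpd_eq_on [:: l] (fun y => @first_kind_symbol i j k y) Ux).
have sd a b c : smooth_on U (dpd [:: a] (gam b c)) := smooth_dpd [:: a] (sgam b c).
have s2 := smoothD oU (sd i j k) (sd j i k).
rewrite (dpdZ _ _ (smoothB oU s2 (sd k i j)) Ux) (dpdB _ s2 (sd k i j) Ux).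
by rewrite (dpdD _ (sd i j k) (sd j i k) Ux) -!dpd_cons.
Qed.

(** Subtracting two differentiated Christoffel symbols cancels the third derivatives of [f], which
    are symmetric. As the second derivatives keep their tangential parts, the quadratic Christoffel
    terms of the curvature sit on the left and the right side is linear in [gam]. *)
Lemma gauss_linear i j k l x : U x ->
  dot (v [:: i; j] x) (v [:: l; k] x) - dot (v [:: i; l] x) (v [:: j; k] x) =
  2^-1 * (dpd [:: l; i] (gam j k) x - dpd [:: l; k] (gam i j) x
    - dpd [:: j; i] (gam l k) x + dpd [:: j; k] (gam i l) x).
Proof.
move=> Ux.
have := first_kind_symbol_derivative l i j k Ux.
have := first_kind_symbol_derivative j i l k Ux.
have -> : v [:: j; i; l] x = v [:: l; i; j] x.
  exact: etrans (jet_swap3 j i l Ux) (etrans (jet_swap j l [:: i] Ux) (jet_swap3 l j i Ux)).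
have -> : dpd [:: j; l] (gam i k) x = dpd [:: l; j] (gam i k) x.
  exact: (dpdC j l [::] (sgam i k) Ux).
by lra.
Qed.

Lemma gauss_linear_derivative m i j k l x : U x ->
  dot (v [:: m; i; j] x) (v [:: l; k] x) + dot (v [:: i; j] x) (v [:: m; l; k] x)
  - dot (v [:: m; i; l] x) (v [:: j; k] x) - dot (v [:: i; l] x) (v [:: m; j; k] x) =
  2^-1 * (dpd [:: m; l; i] (gam j k) x - dpd [:: m; l; k] (gam i j) x
    - dpd [:: m; j; i] (gam l k) x + dpd [:: m; j; k] (gam i l) x).
Proof.
move=> Ux.
have sv s t : smooth_on U (fun y => dot (v s y) (v t y)).
  by rewrite jet_dotE; apply: (smooth_sum oU) => al; exact: smooth_jet_mul.
have := dpd_eq_on [:: m] (fun y => @gauss_linear i j k l y) Ux.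
rewrite (dpdB _ (sv _ _) (sv _ _) Ux) !dpd_jet_dot // opprD addrA => ->.
have sd a b c d : smooth_on U (dpd [:: a; b] (gam c d)) := smooth_dpd [:: a; b] (sgam c d).
have s2 := smoothB oU (sd l i j k) (sd l k i j).
have s3 := smoothB oU s2 (sd j i l k).
rewrite (dpdZ _ _ (smoothD oU s3 (sd j k i l)) Ux) (dpdD _ s3 (sd j k i l) Ux).
rewrite (dpdB _ s2 (sd j i l k) Ux) (dpdB _ (sd l i j k) (sd l k i j) Ux).
by rewrite -!dpd_cons.
Qed.

(** The reference values are the derivatives at 0 of the round metric delta_ij + u_i u_j / (1 -
    |u|^2). [obstruction] is twice the expression in [obstruction_small], whence the doubled
    constant. *)
Lemma obstruction_quadratic (x : E4 R) (eta : R) : U x ->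
  eta <= (1000 * 1000)^-1 ->
  (forall i j, `|gam i j x - (i == j)%:R| <= eta) ->
  (forall k i j, `|dpd [:: k] (gam i j) x| <= eta) ->
  (forall l k i j, `|dpd [:: l; k] (gam i j) x
    - ((l == i)%:R * (k == j)%:R + (l == j)%:R * (k == i)%:R)| <= eta) ->
  (forall m l k i j, `|dpd [:: m; l; k] (gam i j) x| <= eta) ->
  `|obstruction gam x| <= 2400 * 1000 * (eta * eta).
Proof.
move=> Ux eta1 h0 h1 h2 h3.
pose a i := v [:: i] x; pose b i j := v [:: i; j] x; pose c i j k := v [:: i; j; k] x.
have -> : 2400 * 1000 * (eta * eta) = 2 * (1200 * 1000 * (eta * eta)) by ring.
have gl' := @gauss_linear_derivative _ _ _ _ _ x Ux.
have H : `|2^-1 * obstruction gam x| <= 1200 * 1000 * (eta * eta).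
  have -> : 2^-1 * obstruction gam x =
    (dot (c o3 o1 o2) (b o3 o3) + dot (b o1 o2) (c o3 o3 o3)
      - dot (c o3 o1 o3) (b o2 o3) - dot (b o1 o3) (c o3 o2 o3))
    - (dot (c o1 o2 o3) (b o1 o1) + dot (b o2 o3) (c o1 o1 o1)
      - dot (c o1 o2 o1) (b o3 o1) - dot (b o2 o1) (c o1 o3 o1)).
    rewrite /a /b /c (gl' o3 o1 o2 o3 o3) (gl' o1 o2 o3 o1 o1) /obstruction.
    by ring.
  apply: (@obstruction_small R a b c eta eta1).
  - by move=> i j; exact: jet_swap.
  - by move=> i j k; exact: jet_swap.
  - by move=> i j k; exact: jet_swap3.
  - by move=> i j; rewrite -gamE.
  - move=> i j k; rewrite first_kind_symbol //.
    by have := h1 i j k; have := h1 j i k; have := h1 k i j; rewrite !ler_norml; clear; lra.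
  - move=> i j k l; rewrite gauss_linear //.
    have := h2 l i j k; have := h2 l k i j; have := h2 j i l k; have := h2 j k i l.
    rewrite (eq_sym l i) (eq_sym k j) (eq_sym k i) (eq_sym j l) (eq_sym j i) (eq_sym k l).
    by rewrite !ler_norml; clear; lra.
  - move=> m i j p; rewrite first_kind_symbol_derivative //.
    have := h2 m i j p; have := h2 m j i p; have := h2 m p i j.
    rewrite (eq_sym p j) (eq_sym p i) (eq_sym j i).
    by rewrite !ler_norml; clear; lra.
  - move=> m i j k l; rewrite gauss_linear_derivative //.
    have := h3 m l i j k; have := h3 m l k i j; have := h3 m j i l k; have := h3 m j k i l.
    by rewrite !ler_norml; clear; lra.
have -> : obstruction gam x = 2 * (2^-1 * obstruction gam x) by field.
by rewrite normrM ger0_norm // ler_wpM2l.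
Qed.

End InducedMetric.

(** * Graph coordinates on the unit sphere *)

Section GraphChart.
Variable R : realType.
Implicit Types (x y z w u v : E4 R).

Definition chart_ball : set (E4 R) := [set u | 0 < 1 - \sum_(i < 3) u 0 (lift ord0 i) ^+ 2].
Local Notation B := chart_ball.

Definition inv_height u : R := (Num.sqrt (1 - \sum_(i < 3) u 0 (lift ord0 i) ^+ 2))^-1.

(* Polynomials in u_1, u_2, u_3 and the reciprocal square root [inv_height]: a class
   closed under differentiation whose derivatives at 0 can be computed. *)
Inductive cexpr :=
| CInt of int | CVar of 'I_3 | CInvHeight | CAdd of cexpr & cexpr | CMul of cexpr & cexpr.

Fixpoint ceval (e : cexpr) : E4 R -> R^o :=
  match e with
  | CInt z => fun=> z%:~R
  | CVar i => fun u => u 0 (lift ord0 i)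
  | CInvHeight => inv_height
  | CAdd a b => fun u => ceval a u + ceval b u
  | CMul a b => fun u => ceval a u * ceval b u
  end.

Fixpoint cderive (i : 'I_3) (e : cexpr) : cexpr :=
  match e with
  | CInt _ => CInt 0
  | CVar j => CInt (i == j)%:Z
  | CInvHeight => CMul (CVar i) (CMul CInvHeight (CMul CInvHeight CInvHeight))
  | CAdd a b => CAdd (cderive i a) (cderive i b)
  | CMul a b => CAdd (CMul (cderive i a) b) (CMul a (cderive i b))
  end.

(** At the origin [inv_height] is 1 and the variables are 0, so all jets there are integers and can
    be computed. *)
Fixpoint ceval0 (e : cexpr) : int :=
  match e with
  | CInt z => z
  | CVar _ => 0
  | CInvHeight => 1
  | CAdd a b => ceval0 a + ceval0 b
  | CMul a b => ceval0 a * ceval0 b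
  end.

Lemma ceval_at0 e : ceval e 0 = (ceval0 e)%:~R.
Proof.
elim: e => [//|i||a IHa b IHb|a IHa b IHb] /=; rewrite ?mxE ?IHa ?IHb ?rmorphD ?rmorphM //.
rewrite /inv_height big1 ?subr0 ?sqrtr1 ?invr1 // => i _.
by rewrite mxE expr0n.
Qed.

Lemma inv_height_sqr u : B u -> (1 - \sum_(i < 3) u 0 (lift ord0 i) ^+ 2) * (inv_height u * inv_height u) = 1.
Proof.
move=> Bu; rewrite -expr2 /inv_height exprVn sqr_sqrtr ?ltW // mulfV //.
by rewrite gt_eqF.
Qed.

Lemma is_derive_radicand u v :
  is_derive u v (fun y => 1 - \sum_(i < 3) y 0 (lift ord0 i) ^+ 2 : R^o)
    (- 2 * \sum_(i < 3) u 0 (lift ord0 i) * v 0 (lift ord0 i)).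
Proof.
have dX (i : 'I_3) : is_derive u v (fun y => y 0 (lift ord0 i) ^+ 2 : R^o)
   (2 * (u 0 (lift ord0 i) * v 0 (lift ord0 i))).
  have d := is_derive_coord u v (lift ord0 i).
  have := is_deriveM d d.
  have -> : (fun y => y 0 (lift ord0 i) : R^o) * (fun y => y 0 (lift ord0 i) : R^o) =
     (fun y => y 0 (lift ord0 i) ^+ 2 : R^o).
    by apply/funext => y; exact: (esym (expr2 _)).
  by move=> h; apply: (is_derive_eq h); rewrite /GRing.scale /=; ring.
have dS := is_derive_sum dX.
have := is_deriveB (is_derive_cst (1 : R^o) u v) dS.
have -> : cst (1 : R^o) - \sum_(i < 3) (fun y => y 0 (lift ord0 i) ^+ 2 : R^o) =
   (fun y => 1 - \sum_(i < 3) y 0 (lift ord0 i) ^+ 2 : R^o).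
  by apply/funext => y; rewrite /= fct_sumE.
by move=> h; apply: (is_derive_eq h); rewrite -mulr_sumr sub0r mulNr.
Qed.

Lemma smooth_radicand :
  smooth_on setT (fun u => 1 - \sum_(i < 3) u 0 (lift ord0 i) ^+ 2 : R^o).
Proof.
  apply: (smoothB openT); first exact: (smooth_cst openT).
  apply: (smooth_sum openT) => i.
  have -> : (fun u => u 0 (lift ord0 i) ^+ 2 : R^o) =
      (fun u => u 0 (lift ord0 i) * u 0 (lift ord0 i)) by apply/funext => u; rewrite expr2.
  by apply: (smoothM openT); exact: (smooth_coord openT).
Qed.

Lemma open_chart_ball : open B.
Proof.
rewrite (_ : B = (fun u => 1 - \sum_(i < 3) u 0 (lift ord0 i) ^+ 2) @^-1` [set z : R | 0 < z]).
  apply: open_comp; last exact: open_gt.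
  by move=> u _; have [] := smooth_radicand [::] (x := u) Logic.I.
by [].
Qed.

Let radicand u : R := 1 - \sum_(i < 3) u 0 (lift ord0 i) ^+ 2.

Let sqrt_radicand_neq0 u : B u -> (Num.sqrt \o radicand) u != 0.
Proof. by move=> Bu; rewrite /= gt_eqF ?sqrtr_gt0. Qed.

Lemma differentiable_sqrt_radicand u : B u ->
  differentiable (Num.sqrt \o radicand : E4 R -> R^o) u.
Proof.
move=> Bu.
have radicand_diff : differentiable (radicand : E4 R -> R^o) u.
  exact: (smooth_differentiable openT smooth_radicand Logic.I).
have sqrt_diff : differentiable (Num.sqrt : R -> R^o) (radicand u).
  by apply/derivable1_diffP; have [] := is_derive1_sqrt Bu.
exact: differentiable_comp.
Qed.

Lemma is_derive_inv_height u v : B u -> is_derive u v (inv_height : E4 R -> R^o)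
  ((\sum_(i < 3) u 0 (lift ord0 i) * v 0 (lift ord0 i)) * inv_height u ^+ 3).
Proof.
move=> Bu.
have [db Db] := is_derive_radicand u v.
have sqrt_rad := differentiable_sqrt_radicand Bu.
have ds : derivable (Num.sqrt \o radicand : E4 R -> R^o) u v by exact: diff_derivable.
have Ds : 'D_v (Num.sqrt \o radicand : E4 R -> R^o) u =
    (2 * Num.sqrt (radicand u))^-1 * 'D_v (radicand : E4 R -> R^o) u.
  have radicand_diff : differentiable (radicand : E4 R -> R^o) u.
    exact: (smooth_differentiable openT smooth_radicand Logic.I).
  have sqrt_diff : differentiable (Num.sqrt : R -> R^o) (radicand u).
    by apply/derivable1_diffP; have [] := is_derive1_sqrt Bu.
  rewrite deriveE // diff_comp //= -[X in 'd Num.sqrt _ X]mulr1.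
  rewrite [_ * 1 in LHS](_ : _ = 'd radicand u v *: 1) // linearZ /= -!deriveE //.
  by have [_ ->] := is_derive1_sqrt Bu; exact: mulrC.
have s0 := sqrt_radicand_neq0 Bu.
have dV := DeriveDef (derivableV s0 ds) (deriveV s0 ds).
apply: (is_derive_eq dV); rewrite Ds Db /GRing.scale /inv_height /= -/(radicand u).
by move: s0 => /=; set q := Num.sqrt _ => s0; field.
Qed.

Lemma smooth_inv_height : smooth_on B (inv_height : E4 R -> R^o).
Proof.
apply: (smooth_alg_on open_chart_ball).
(* The reciprocal square root solves d_i k = u_i k^3, with coefficient 0 for the ignored
   coordinate. *)
pose a (i : 'I_4) : E4 R -> R^o := if unlift ord0 i is Some j then fun u => u 0 (lift ord0 j)
  else fun=> 0.
apply: (@alg_ode _ _ _ a 3).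
- move=> u Bu; apply: differentiable_continuous.
  exact: (differentiableV (differentiable_sqrt_radicand Bu) (sqrt_radicand_neq0 Bu)).
- move=> i; rewrite /a; case: unliftP => [j|] _.
    exact: (smooth_coord open_chart_ball).
  exact: (smooth_cst open_chart_ball).
- move=> i u Bu; apply: (is_derive_eq (is_derive_inv_height _ Bu)).
  rewrite /a; congr (_ * _); case: unliftP => [j|] ->.
    rewrite (bigD1 j) //= big1 ?addr0 ?mxE ?eqxx ?mulr1 // => k kj.
    by rewrite mxE /= (inj_eq lift_inj) (negbTE kj) mulr0.
  by rewrite big1 // => k _; rewrite mxE mulr0.
Qed.

Lemma smooth_ceval e : smooth_on B (ceval e).
Proof.
have oB := open_chart_ball.
elim: e => [z|i||a IHa b IHb|a IHa b IHb] /=.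
- exact: smooth_cst.
- exact: smooth_coord.
- exact: smooth_inv_height.
- exact: smoothD.
- exact: smoothM.
Qed.

Lemma dpd_coord i j u : B u -> dpd [:: i] (fun y => y 0 (lift ord0 j) : R^o) u = (i == j)%:R.
Proof.
move=> Bu; rewrite dpd.unlock /=.
have [_ ->] := is_derive_coord u (delta_mx 0 (lift ord0 i)) (lift ord0 j).
by rewrite mxE /= (inj_eq lift_inj) eq_sym.
Qed.

Lemma dpd1_ceval i e u : B u -> dpd [:: i] (ceval e) u = ceval (cderive i e) u.
Proof.
move=> Bu; have oB := open_chart_ball.
elim: e => [z|j||a IHa b IHb|a IHa b IHb] /=.
- by rewrite dpd.unlock /= derive_cst.
- by rewrite dpd_coord //; case: (i == j).
- rewrite dpd.unlock /=; have [_ ->] := is_derive_inv_height (delta_mx 0 (lift ord0 i)) Bu.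
  rewrite (bigD1 i) //= big1 ?addr0 => [|k ki]; rewrite mxE /=.
    by rewrite eqxx mulr1 !exprS expr0 mulr1.
  by rewrite (inj_eq lift_inj) (negbTE ki) mulr0.
- by rewrite (dpdD oB _ (smooth_ceval a) (smooth_ceval b) Bu) IHa IHb.
- by rewrite (dpd1M _ (smooth_ceval a) (smooth_ceval b) Bu) IHa IHb.
Qed.

Lemma dpd_ceval s e u : B u -> dpd s (ceval e) u = ceval (foldr cderive e s) u.
Proof.
elim: s u => [|i s IH] u Bu; first by rewrite dpd.unlock.
by rewrite dpd_cons (dpd_eq_on open_chart_ball [:: i] IH Bu) dpd1_ceval.
Qed.

Lemma chart_ball0 : B 0.
Proof. by rewrite /B /= big1 ?subr0 // => i _; rewrite mxE expr0n. Qed.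

Lemma dpd_ceval0 s e : dpd s (ceval e) 0 = (ceval0 (foldr cderive e s))%:~R.
Proof. by rewrite dpd_ceval ?ceval_at0 //; exact: chart_ball0. Qed.

End GraphChart.

(** * Weyl tensors *)

Section QuadrilinearForm.
Variable R : realType.
Implicit Types (x y z w : E4 R) (W : tensor4 R).

Definition quad W x y z w : R :=
  \sum_i \sum_j \sum_k \sum_l W i j k l * x 0 i * y 0 j * z 0 k * w 0 l.

Lemma quad_linear1 W y z w : linear (fun x => quad W x y z w : R^o).
Proof.
move=> a x x'; rewrite /quad /GRing.scale /= mulr_sumr -big_split; apply: eq_bigr => i _ /=.
rewrite mulr_sumr -big_split; apply: eq_bigr => j _ /=.
rewrite mulr_sumr -big_split; apply: eq_bigr => k _ /=.
rewrite mulr_sumr -big_split; apply: eq_bigr => l _ /=.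
by rewrite !mxE; ring.
Qed.

Lemma quad_linear2 W x z w : linear (fun y => quad W x y z w : R^o).
Proof.
move=> a y y'; rewrite /quad /GRing.scale /= mulr_sumr -big_split; apply: eq_bigr => i _ /=.
rewrite mulr_sumr -big_split; apply: eq_bigr => j _ /=.
rewrite mulr_sumr -big_split; apply: eq_bigr => k _ /=.
rewrite mulr_sumr -big_split; apply: eq_bigr => l _ /=.
by rewrite !mxE; ring.
Qed.

Lemma quad_linear3 W x y w : linear (fun z => quad W x y z w : R^o).
Proof.
move=> a z z'; rewrite /quad /GRing.scale /= mulr_sumr -big_split; apply: eq_bigr => i _ /=.
rewrite mulr_sumr -big_split; apply: eq_bigr => j _ /=.
rewrite mulr_sumr -big_split; apply: eq_bigr => k _ /=.
rewrite mulr_sumr -big_split; apply: eq_bigr => l _ /=.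
by rewrite !mxE; ring.
Qed.

Lemma quad_linear4 W x y z : linear (fun w => quad W x y z w : R^o).
Proof.
move=> a w w'; rewrite /quad /GRing.scale /= mulr_sumr -big_split; apply: eq_bigr => i _ /=.
rewrite mulr_sumr -big_split; apply: eq_bigr => j _ /=.
rewrite mulr_sumr -big_split; apply: eq_bigr => k _ /=.
rewrite mulr_sumr -big_split; apply: eq_bigr => l _ /=.
by rewrite !mxE; ring.
Qed.

Lemma linear_mulmx (f : E4 R -> R^o) x (Q : 'M[R]_4) : linear f ->
  f (x *m Q) = \sum_p x 0 p * f (row p Q).
Proof.
move=> lf.
have f0 : f 0 = 0.
  have := lf 1 0 0; rewrite scaler0 addr0 scale1r => /eqP.
  by rewrite -subr_eq0 opprD addrA subrr sub0r oppr_eq0 => /eqP.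
rewrite mulmx_sum_row; elim: (index_enum _) => [|p r IH]; first by rewrite !big_nil.
by rewrite !big_cons lf IH.
Qed.

(** Separates the 256 constants, which depend on [W] and [Q], from monomials in the coordinates,
    which do not and can be differentiated symbolically. *)
Lemma quad_mulmx W x y z w (Q : 'M[R]_4) :
  quad W (x *m Q) (y *m Q) (z *m Q) (w *m Q) =
  \sum_(t : 'I_4 * 'I_4 * 'I_4 * 'I_4)
    quad W (row t.1.1.1 Q) (row t.1.1.2 Q) (row t.1.2 Q) (row t.2 Q) *
    (x 0 t.1.1.1 * y 0 t.1.1.2 * z 0 t.1.2 * w 0 t.2).
Proof.
pose F p q m n := quad W (row p Q) (row q Q) (row m Q) (row n Q) *
    (x 0 p * y 0 q * z 0 m * w 0 n).
transitivity (\sum_p \sum_q \sum_m \sum_n F p q m n); last first.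
  rewrite pair_bigA /= pair_bigA /= pair_bigA /=.
  by apply: eq_bigr => t _.
rewrite (linear_mulmx _ _ (quad_linear1 W _ _ _)); apply: eq_bigr => p _.
rewrite (linear_mulmx _ _ (quad_linear2 W _ _ _)) mulr_sumr; apply: eq_bigr => q _.
rewrite (linear_mulmx _ _ (quad_linear3 W _ _ _)) !mulr_sumr; apply: eq_bigr => m _.
rewrite (linear_mulmx _ _ (quad_linear4 W _ _ _)) !mulr_sumr; apply: eq_bigr => n _.
by rewrite /F; ring.
Qed.

Section Symmetries.
Variables (W : tensor4 R) (hW : algebraic_weyl W).

Lemma quad_anti12 x y z w : quad W y x z w = - quad W x y z w.
Proof.
case: hW => [h _ _ _ _]; rewrite /quad exchange_big -sumrN; apply: eq_bigr => i _.
rewrite -sumrN; apply: eq_bigr => j _; rewrite -sumrN; apply: eq_bigr => k _.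
by rewrite -sumrN; apply: eq_bigr => l _; rewrite h; ring.
Qed.

Lemma quad_anti34 x y z w : quad W x y w z = - quad W x y z w.
Proof.
case: hW => [_ h _ _ _]; rewrite /quad -sumrN; apply: eq_bigr => i _.
rewrite -sumrN; apply: eq_bigr => j _; rewrite exchange_big -sumrN; apply: eq_bigr => k _.
by rewrite -sumrN; apply: eq_bigr => l _; rewrite h; ring.
Qed.

Lemma quad_pair x y z w : quad W z w x y = quad W x y z w.
Proof.
case: hW => [_ _ h _ _]; rewrite /quad.
rewrite pair_bigA [RHS]pair_bigA /=.
under eq_bigr do rewrite pair_bigA /=.
under [RHS]eq_bigr do rewrite pair_bigA /=.
rewrite exchange_big; apply: eq_bigr => -[i j] _; apply: eq_bigr => -[k l] _ /=.
by rewrite h; ring.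
Qed.

Lemma quad_bianchi x y z w : quad W x y z w + quad W y z x w + quad W z x y w = 0.
Proof.
case: hW => [_ _ _ h _].
have -> : quad W y z x w =
    \sum_i \sum_j \sum_k \sum_l W j k i l * x 0 i * y 0 j * z 0 k * w 0 l.
  rewrite /quad; under eq_bigr do rewrite exchange_big.
  rewrite exchange_big; do 4!(apply: eq_bigr => ? _); ring.
have -> : quad W z x y w =
    \sum_i \sum_j \sum_k \sum_l W k i j l * x 0 i * y 0 j * z 0 k * w 0 l.
  rewrite /quad exchange_big; under eq_bigr do rewrite exchange_big.
  do 4!(apply: eq_bigr => ? _); ring.
rewrite /quad -!big_split big1 // => i _ /=; rewrite -!big_split big1 // => j _ /=.
rewrite -!big_split big1 // => k _ /=; rewrite -!big_split big1 // => l _ /=.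
by rewrite -!mulrDl h !mul0r.
Qed.

End Symmetries.
End QuadrilinearForm.

(** * The graph chart in an orthonormal frame and the jets of the round metric *)

Section SphereChart.
Variable R : realType.
Implicit Types (x y z w u v : E4 R) (Q : 'M[R]_4).

Local Notation o1 := (@Ordinal 3 0 isT).
Local Notation o2 := (@Ordinal 3 1 isT).
Local Notation o3 := (@Ordinal 3 2 isT).

Definition radicand_expr : cexpr :=
  CAdd (CInt 1) (CMul (CInt (-1)) (CAdd (CMul (CVar o1) (CVar o1))
    (CAdd (CMul (CVar o2) (CVar o2)) (CMul (CVar o3) (CVar o3))))).

(* Index 0 is the height sqrt (1 - |u|^2), written (1 - |u|^2) / sqrt (1 - |u|^2). *)
Definition graph_coord (p : 'I_4) : cexpr :=
  match val p with
  | 0 => CMul radicand_expr CInvHeight | 1 => CVar o1 | 2 => CVar o2 | _ => CVar o3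
  end.

(** The rows of [Q] are the frame; the chart sends 0 to the row of index 0. *)
Definition sphere_chart Q u : E4 R := (\row_p ceval (graph_coord p) u) *m Q.

Definition sphere_frame Q (i : 'I_3) u : E4 R :=
  (\row_p ceval (cderive i (graph_coord p)) u) *m Q.

(** The round metric in the chart; [Q] is absent because an orthogonal matrix preserves [dot]. *)
Definition round_expr (i j : 'I_3) : cexpr :=
  foldr CAdd (CInt 0) [seq CMul (cderive i (graph_coord p)) (cderive j (graph_coord p))
    | p <- [:: ord0; lift ord0 o1; lift ord0 o2; lift ord0 o3]].

Lemma sum4E (F : 'I_4 -> R) :
  \sum_p F p = F ord0 + (F (lift ord0 o1) + (F (lift ord0 o2) + F (lift ord0 o3))).
Proof.
rewrite !big_ord_recl big_ord0 addr0.
by do ![congr (_ + _)]; congr F; exact: val_inj.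
Qed.

Lemma sum3E (F : 'I_3 -> R) : \sum_p F p = F o1 + (F o2 + F o3).
Proof.
rewrite !big_ord_recl big_ord0 addr0.
by do ![congr (_ + _)]; congr F; exact: val_inj.
Qed.

Lemma dot_mulmx_orthogonal Q x y : Q *m Q^T = 1%:M -> dot (x *m Q) (y *m Q) = dot x y.
Proof. by move=> QQ; rewrite !dotE trmx_mul mulmxA -(mulmxA x) QQ mulmx1. Qed.

Section Orthogonal.
Variables (Q : 'M[R]_4) (QQ : Q *m Q^T = 1%:M).

Lemma sphere_chart_unit u : chart_ball u -> dot (sphere_chart Q u) (sphere_chart Q u) = 1.
Proof.
move=> Bu; rewrite dot_mulmx_orthogonal // /dot sum4E !mxE /graph_coord /=.
have := inv_height_sqr Bu; rewrite sum3E.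
set t := inv_height u; set a := u 0 _; set b := u 0 _; set c := u 0 _ => h.
transitivity ((1 - (a ^+ 2 + (b ^+ 2 + c ^+ 2))) * ((1 - (a ^+ 2 + (b ^+ 2 + c ^+ 2))) * (t * t))
  + (a ^+ 2 + (b ^+ 2 + c ^+ 2))); first by ring.
by rewrite h; ring.
Qed.

Lemma sphere_frame_tangent i u : chart_ball u ->
  dot (sphere_frame Q i u) (sphere_chart Q u) = 0.
Proof.
move=> Bu; rewrite dot_mulmx_orthogonal // /dot sum4E !mxE /graph_coord /=.
have := inv_height_sqr Bu; rewrite sum3E.
set t := inv_height u; set a := u 0 _; set b := u 0 _; set c := u 0 _ => h.
pose q : R := 1 - (a ^+ 2 + (b ^+ 2 + c ^+ 2)).
(* The first factor is the symbolic derivative of the height [q * t] in the variable [y]; the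
   relation [q * (t * t) = 1] reduces the sum to - 2 y + y + y. *)
have key (y : R) : (- 2 * y * t + q * (y * (t * (t * t)))) * (q * t) + y = 0.
  transitivity (- 2 * y * (q * (t * t)) + y * (q * (t * t)) * (q * (t * t)) + y); first by ring.
  by rewrite h; ring.
elim/ord3_ind: i => /=; rewrite -/a -/b -/c.
- by rewrite -[RHS](key a) /q; ring.
- by rewrite -[RHS](key b) /q; ring.
- by rewrite -[RHS](key c) /q; ring.
Qed.

Lemma dot_sphere_frame i j u :
  dot (sphere_frame Q i u) (sphere_frame Q j u) = ceval (round_expr i j) u.
Proof.
rewrite dot_mulmx_orthogonal // /dot sum4E !mxE /=; ring.
Qed.

End Orthogonal.

Lemma smooth_sphere_chart Q a : smooth_on (@chart_ball R) (fun u => sphere_chart Q u 0 a : R^o).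
Proof.
have oB := @open_chart_ball R.
have -> : (fun u => sphere_chart Q u 0 a : R^o) =
    (fun u => \sum_p ceval (graph_coord p) u * Q p a).
  by apply/funext => u; rewrite mxE; apply: eq_bigr => p _; rewrite mxE.
apply: (smooth_sum oB) => p; apply: (smoothM oB); first exact: smooth_ceval.
exact: (smooth_cst oB).
Qed.

Lemma dpd_sphere_chart Q i a u : chart_ball u ->
  dpd [:: i] (fun y => sphere_chart Q y 0 a : R^o) u = sphere_frame Q i u 0 a.
Proof.
move=> Bu; have oB := @open_chart_ball R.
have -> : (fun u => sphere_chart Q u 0 a : R^o) =
    (fun u => \sum_p Q p a * ceval (graph_coord p) u).
  by apply/funext => y; rewrite mxE; apply: eq_bigr => p _; rewrite mxE mulrC.
rewrite (dpd_sum oB) //; last by move=> p; apply: (smoothZ oB); exact: smooth_ceval.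
rewrite mxE; apply: eq_bigr => p _; rewrite mxE (dpdZ oB) //; last exact: smooth_ceval.
by rewrite dpd1_ceval // mulrC.
Qed.

(** On [chart_ball] the metric is delta_ij + u_i u_j / (1 - |u|^2), which is even in u: its jets of
    odd order vanish at 0, and up to order three only delta_ij + u_i u_j is seen. All index choices
    are checked by computation, here and for the next three jets. *)
Lemma round_jet0 i j : ceval0 (round_expr i j) = (i == j)%:Z.
Proof. by elim/ord3_ind: i; elim/ord3_ind: j; vm_compute. Qed.

Lemma round_jet1 k i j : ceval0 (foldr cderive (round_expr i j) [:: k]) = 0.
Proof. by elim/ord3_ind: i; elim/ord3_ind: j; elim/ord3_ind: k; vm_compute. Qed.

Lemma round_jet2 l k i j : ceval0 (foldr cderive (round_expr i j) [:: l; k]) =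
  (l == i)%:Z * (k == j)%:Z + (l == j)%:Z * (k == i)%:Z.
Proof.
by elim/ord3_ind: i; elim/ord3_ind: j; elim/ord3_ind: k; elim/ord3_ind: l; vm_compute.
Qed.

Lemma round_jet3 m l k i j : ceval0 (foldr cderive (round_expr i j) [:: m; l; k]) = 0.
Proof.
by elim/ord3_ind: i; elim/ord3_ind: j; elim/ord3_ind: k; elim/ord3_ind: l;
  elim/ord3_ind: m; vm_compute.
Qed.

End SphereChart.

(** * The value of the obstruction on the Weyl term *)

Section ObstructionOfWeyl.
Variable R : realType.
Implicit Types (x y z w u v : E4 R) (Q : 'M[R]_4).

Local Notation o1 := (@Ordinal 3 0 isT).
Local Notation o2 := (@Ordinal 3 1 isT).
Local Notation o3 := (@Ordinal 3 2 isT).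
Local Notation d0 := (@Ordinal 4 0 isT).
Local Notation d1 := (@Ordinal 4 1 isT).
Local Notation d2 := (@Ordinal 4 2 isT).
Local Notation d3 := (@Ordinal 4 3 isT).

Definition weyl_expr (t : 'I_4 * 'I_4 * 'I_4 * 'I_4) (i j : 'I_3) : cexpr :=
  CMul (CMul (CMul (cderive i (graph_coord t.1.1.1)) (graph_coord t.1.1.2))
    (graph_coord t.1.2)) (cderive j (graph_coord t.2)).

Definition obstruction_int (e : 'I_3 -> 'I_3 -> cexpr) : int :=
  let d s i j := ceval0 (foldr cderive (e i j) s) in
  (d [:: o3; o3; o1] o2 o3 - d [:: o3; o3; o3] o1 o2
    - d [:: o3; o2; o1] o3 o3 + d [:: o3; o2; o3] o1 o3)
  - (d [:: o1; o1; o2] o3 o1 - d [:: o1; o1; o1] o2 o3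
    - d [:: o1; o3; o2] o1 o1 + d [:: o1; o3; o1] o2 o1).

Lemma obstruction_sum (I : finType) (K : I -> R) (e : I -> 'I_3 -> 'I_3 -> cexpr) :
  obstruction (fun i j u => \sum_t K t * ceval (e t i j) u : R^o) 0 =
  \sum_t K t * (obstruction_int (e t))%:~R.
Proof.
have oB := @open_chart_ball R; have B0 := @chart_ball0 R.
have dE s i j : dpd s (fun u => \sum_t K t * ceval (e t i j) u : R^o) 0 =
    \sum_t K t * (ceval0 (foldr cderive (e t i j) s))%:~R.
  have sK t : smooth_on (@chart_ball R) (fun u => K t * ceval (e t i j) u : R^o).
    by apply: (smoothZ oB); exact: smooth_ceval.
  rewrite (dpd_sum oB _ _ sK B0); apply: eq_bigr => t _.
  by rewrite (dpdZ oB _ _ (smooth_ceval (e t i j)) B0) dpd_ceval0.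
rewrite /obstruction !dE -!sumrB -!big_split -!sumrB.
apply: eq_bigr => t _ /=; rewrite /obstruction_int !(rmorphB, rmorphD); ring.
Qed.

(** An explicit list, so that the 256 integer coefficients can be evaluated by computation. *)
Definition index4 := [:: d0; d1; d2; d3].

Lemma mem_index4 (i : 'I_4) : i \in index4.
Proof. by case: i => [[|[|[|[|//]]]] hi]; rewrite !inE -!val_eqE. Qed.

Definition index4_tuples : seq ('I_4 * 'I_4 * 'I_4 * 'I_4) :=
  [seq (t, n) | t <- [seq (t, m) | t <- [seq (p, q) | p <- index4, q <- index4],
     m <- index4], n <- index4].

Lemma sum_index4_tuples (F : 'I_4 * 'I_4 * 'I_4 * 'I_4 -> R) :
  \sum_t F t = \sum_(t <- index4_tuples) F t.
Proof.
apply: perm_big; apply: uniq_perm; first exact: index_enum_uniq.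
  by vm_compute.
move=> [[[p q] m] n]; rewrite mem_index_enum; apply/esym.
by do 3!(apply: allpairs_f; last exact: mem_index4); exact: mem_index4.
Qed.

(* The nonzero values of [obstruction_int (weyl_expr t)], found by computation. *)
Definition weyl_coefficients : seq ('I_4 * 'I_4 * 'I_4 * 'I_4 * int) :=
  [:: (d0, d1, d2, d3, 1); (d0, d2, d1, d3, 1); (d0, d2, d3, d1, -1); (d0, d3, d2, d1, -1);
      (d1, d0, d2, d3, -1); (d1, d0, d3, d2, 3%Z); (d1, d2, d0, d3, -1);
      (d1, d2, d3, d0, (-3)%Z); (d1, d3, d0, d2, 3%Z); (d1, d3, d2, d0, (-3)%Z);
      (d2, d0, d1, d3, (-4)%Z); (d2, d0, d3, d1, 1); (d2, d1, d0, d3, (-4)%Z);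
      (d2, d3, d0, d1, 1); (d3, d0, d2, d1, 1); (d3, d1, d2, d0, 3%Z); (d3, d2, d0, d1, 1);
      (d3, d2, d1, d0, 3%Z)].

Lemma weyl_coefficientsE :
  [seq (t, obstruction_int (weyl_expr t)) | t <- index4_tuples &
    obstruction_int (weyl_expr t) != 0] = weyl_coefficients.
Proof. by vm_compute. Qed.

Lemma sum_nonzero_coefficients (T : Type) (r : seq T) (K : T -> R) (k : T -> int) :
  \sum_(t <- r) K t * (k t)%:~R =
  \sum_(c <- [seq (t, k t) | t <- r & k t != 0]) K c.1 * c.2%:~R.
Proof.
rewrite big_map big_filter [RHS]big_mkcond /=.
by apply: eq_bigr => t _; case: eqP => [-> | _] //=; rewrite mulr0.
Qed.

Lemma obstruction_weyl (W : tensor4 R) (Q : 'M[R]_4) : algebraic_weyl W ->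
  obstruction (fun i j u => quad W (sphere_frame Q i u) (sphere_chart Q u)
    (sphere_chart Q u) (sphere_frame Q j u) : R^o) 0 =
  - 24 * quad W (row d0 Q) (row d2 Q) (row d3 Q) (row d1 Q).
Proof.
move=> hW.
pose K (t : 'I_4 * 'I_4 * 'I_4 * 'I_4) :=
  quad W (row t.1.1.1 Q) (row t.1.1.2 Q) (row t.1.2 Q) (row t.2 Q).
have -> : (fun i j u => quad W (sphere_frame Q i u) (sphere_chart Q u)
    (sphere_chart Q u) (sphere_frame Q j u) : R^o) =
    (fun i j u => \sum_t K t * ceval (weyl_expr t i j) u).
  apply/funext => i; apply/funext => j; apply/funext => u; rewrite quad_mulmx.
  by apply: eq_bigr => t _; rewrite !mxE.
apply: etrans (obstruction_sum K weyl_expr) _.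
apply: etrans (sum_index4_tuples _) _.
apply: etrans (sum_nonzero_coefficients _ _ _) _.
apply: etrans (congr1 (fun r => \sum_(c <- r) K c.1 * c.2%:~R) weyl_coefficientsE) _.
rewrite /weyl_coefficients !big_cons big_nil /K /=.
have A := quad_anti12 hW; have B := quad_anti34 hW; have C := quad_pair hW.
set r0 := row d0 Q; set r1 := row d1 Q; set r2 := row d2 Q; set r3 := row d3 Q.
(* The eighteen terms, all with four distinct indices, reduce by the other symmetries to 8 W(r0, r1,
   r2, r3) - 16 W(r0, r2, r3, r1) + 8 W(r0, r3, r1, r2); the Bianchi identity turns this into the
   single term with -24. *)
have := quad_bianchi hW r1 r2 r3 r0.
rewrite !(B _ _ r0 _) !(C r0) !(A r0) !(B r0 r1 r2 r3) !(B r0 r2 r3 r1) !(B r0 r3 r1 r2).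
by rewrite mulr1z; clear; lra.
Qed.

End ObstructionOfWeyl.

(** * Weyl tensors that vanish on all orthonormal frames *)

Section WeylVanishing.
Variables (R : realType) (W : tensor4 R) (hW : algebraic_weyl W).
Implicit Types (x y z w : E4 R).

Local Notation e_ i := (delta_mx 0 i : E4 R).
Local Notation d0 := (@Ordinal 4 0 isT).
Local Notation d1 := (@Ordinal 4 1 isT).
Local Notation d2 := (@Ordinal 4 2 isT).
Local Notation d3 := (@Ordinal 4 3 isT).

Lemma quad_delta i j k l : quad W (e_ i) (e_ j) (e_ k) (e_ l) = W i j k l.
Proof.
have sum_delta (F : 'I_4 -> R) a : \sum_b F b * e_ a 0 b = F a.
  rewrite (bigD1 a) //= mxE !eqxx mulr1 big1 ?addr0 // => b ba.
  by rewrite mxE /= (negbTE ba) mulr0.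
rewrite /quad -(sum_delta (fun i => W i j k l)); apply: eq_bigr => i' _.
rewrite -(sum_delta (fun j => W i' j k l)) mulr_suml; apply: eq_bigr => j' _.
rewrite -(sum_delta (fun k => W i' j' k l)) !mulr_suml; apply: eq_bigr => k' _.
rewrite -(sum_delta (fun l => W i' j' k' l)) !mulr_suml; apply: eq_bigr => l' _.
ring.
Qed.

Lemma linear_rules (f : E4 R -> R^o) : linear f ->
  [/\ forall x y, f (x + y) = f x + f y, forall x y, f (x - y) = f x - f y
    & forall (a : R) x, f (a *: x) = a * f x].
Proof.
move=> lf.
have f0 : f 0 = 0 by have := linear_mulmx 0 0 lf; rewrite mul0mx big1 // => i _; rewrite mxE mul0r.
split=> [x y|x y|a x].
- by have := lf 1 x y; rewrite !scale1r.
- by have := lf (-1) y x; rewrite !scaleN1r ![- _ + _]addrC.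
- by have := lf a x 0; rewrite f0 !addr0.
Qed.

Lemma uniq4E (T : eqType) (a b c d : T) : uniq [:: a; b; c; d] =
  [&& a != b, a != c, a != d, b != c, b != d & c != d].
Proof. by rewrite /= !inE !negb_or !andbT -!andbA. Qed.

Lemma sum_uniq4 a b c d (F : 'I_4 -> R) : uniq [:: a; b; c; d] ->
  \sum_i F i = F a + F b + F c + F d.
Proof.
move=> abcd; transitivity (\sum_(i <- [:: a; b; c; d]) F i); last first.
  by rewrite !big_cons big_nil addr0 !addrA.
rewrite (big_uniq _ abcd); apply: eq_bigl => i; apply/esym.
have /subset_cardP : #|[:: a; b; c; d]| = #|{: 'I_4}| by rewrite (card_uniqP abcd) card_ord.
by move=> /(_ (subset_predT _)) ->.
Qed.

Hypothesis frame0 : forall Q : 'M[R]_4, Q *m Q^T = 1%:M ->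
  quad W (row d0 Q) (row d2 Q) (row d3 Q) (row d1 Q) = 0.

(** Normalizing once here lets the rotated frames be written with integer vectors e_a + e_c and e_a
    - e_c. *)
Lemma quad_orthogonal0 x y z w : x != 0 -> y != 0 -> z != 0 -> w != 0 ->
  dot x y = 0 -> dot x z = 0 -> dot x w = 0 -> dot y z = 0 -> dot y w = 0 -> dot z w = 0 ->
  quad W x y z w = 0.
Proof.
move=> x0 y0 z0 w0 xy xz xw yz yw zw.
pose k v : R := (Num.sqrt (dot v v))^-1.
have k0 v : v != 0 -> k v != 0.
  by move=> v0; rewrite invr_eq0 gt_eqF // sqrtr_gt0 lt_neqAle dot_ge0 eq_sym dot_eq0 v0.
have kk v : v != 0 -> k v * (k v * dot v v) = 1.
  move=> v0; rewrite mulrA -expr2 exprVn sqr_sqrtr ?dot_ge0 // mulVf //.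
  by rewrite dot_eq0.
have [yx zx wx] : [/\ dot y x = 0, dot z x = 0 & dot w x = 0] by rewrite ![dot _ x]dotC.
have [zy wy wz] : [/\ dot z y = 0, dot w y = 0 & dot w z = 0].
  by rewrite ![dot _ y]dotC [dot w z]dotC.
(* The vector [w] comes second because [frame0] reads the rows in the order 0, 2, 3, 1. *)
pose Q : 'M[R]_4 := \matrix_i nth 0 [:: k x *: x; k w *: w; k y *: y; k z *: z] i.
have QQ : Q *m Q^T = 1%:M.
  apply/matrixP => i j; rewrite mxE.
  transitivity (dot (row i Q) (row j Q)).
    by apply: eq_bigr => a _; rewrite !mxE.
  rewrite !rowK mxE.
  by case: i => [[|[|[|[|//]]]] hi]; case: j => [[|[|[|[|//]]]] hj] /=;
    rewrite dotZl dotZr ?kk // ?(xy, xz, xw, yz, yw, zw) ?(yx, zx, wx, zy, wy, wz) ?mulr0.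
have := frame0 QQ; rewrite !rowK /=.
have [_ _ ->] := linear_rules (quad_linear1 W (k y *: y) (k z *: z) (k w *: w)).
have [_ _ ->] := linear_rules (quad_linear2 W x (k z *: z) (k w *: w)).
have [_ _ ->] := linear_rules (quad_linear3 W x y (k w *: w)).
have [_ _ ->] := linear_rules (quad_linear4 W x y z).
by move/eqP; rewrite !mulf_eq0 !(negbTE (k0 _ _)) //= => /eqP.
Qed.

(* Besides the standard basis, the frames used rotate one coordinate plane by 45
   degrees, which with the trace condition kills W_abad, or two planes at once,
   which equates sectional curvatures. *)
Lemma weyl_vanishing i j k l : W i j k l = 0.
Proof.
have [h12 h34 hp _ ht] := hW.
have ne0 i1 : e_ i1 != 0.
  by apply/eqP => /rowP/(_ i1)/eqP; rewrite !mxE !eqxx oner_eq0.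
have ee (a b : 'I_4) : dot (e_ a) (e_ b) = (a == b)%:R.
  rewrite /dot (bigD1 a) //= [X in _ + X]big1; first by rewrite addr0 !mxE !eqxx mul1r.
  by move=> c ca; rewrite mxE /= (negbTE ca) mul0r.
have D1 x y z w x' : quad W (x + x') y z w = quad W x y z w + quad W x' y z w.
  by have [->] := linear_rules (quad_linear1 W y z w).
have D2 x y z w x' : quad W x (y + x') z w = quad W x y z w + quad W x x' z w.
  by have [->] := linear_rules (quad_linear2 W x z w).
have B3 x y z w x' : quad W x y (z - x') w = quad W x y z w - quad W x y x' w.
  by have [_ ->] := linear_rules (quad_linear3 W x y w).
have B4 x y z w x' : quad W x y z (w - x') = quad W x y z w - quad W x y z x'.
  by have [_ ->] := linear_rules (quad_linear4 W x y z).
have eD a b : a != b -> e_ a + e_ b != 0.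
  move=> ab; apply/eqP => /rowP/(_ a)/eqP.
  by rewrite !mxE !eqxx /= (negbTE ab) addr0 oner_eq0.
have eB a b : a != b -> e_ a - e_ b != 0.
  move=> ab; apply/eqP => /rowP/(_ a)/eqP.
  by rewrite !mxE !eqxx /= (negbTE ab) subr0 oner_eq0.
have diag0 a c d : W a a c d = 0 by have := h12 a a c d; lra.
have diag0' a c d : W c d a a = 0 by have := h34 c d a a; lra.
have distinct0 a b c d : uniq [:: a; b; c; d] -> W a b c d = 0.
  rewrite uniq4E => /and5P[ab ac ad bc /andP[bd cd]].
  rewrite -quad_delta; apply: quad_orthogonal0; rewrite // ee;
    by rewrite ?(negbTE ab) ?(negbTE ac) ?(negbTE ad) ?(negbTE bc) ?(negbTE bd) ?(negbTE cd).
have share0 a b c d : uniq [:: a; b; c; d] -> W a b a d = 0.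
  move=> abcd; have := abcd.
  rewrite uniq4E => /and5P[ab ac ad bc /andP[bd cd]].
  have := @quad_orthogonal0 (e_ a + e_ c) (e_ b) (e_ a - e_ c) (e_ d).
  rewrite !(D1, B3) !quad_delta eD // eB // !ne0.
  rewrite !(dotBl, dotBr, dotDl, dotDr) !ee !eqxx.
  rewrite (eq_sym c a) (eq_sym c b) (eq_sym b a) (negbTE ab) (negbTE ac) (negbTE ad)
    (negbTE bc) (negbTE bd) (negbTE cd).
  have := ht b d; rewrite (sum_uniq4 _ abcd) diag0 diag0'.
  have := distinct0 a b c d abcd.
  have -> : W c b a d = 0.
    by apply: distinct0; rewrite uniq4E (eq_sym c b) (eq_sym c a) (eq_sym b a) bc ac cd ab bd ad.
  move=> -> s H.
  have {}H : W a b a d - 0 + (0 - W c b c d) = 0.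
    by apply: H; rewrite //= ?mulr0n ?mulr1n; lra.
  by move: s H; lra.
have double_frame a b c d : uniq [:: a; b; c; d] ->
    W a b a b - W a d a d - W c b c b + W c d c d = 0.
  rewrite uniq4E => /and5P[ab ac ad bc /andP[bd cd]].
  have [ba ca da] : [/\ b != a, c != a & d != a] by rewrite ![_ == a]eq_sym.
  have [cb db dc] : [/\ c != b, d != b & d != c] by rewrite ![_ == b]eq_sym [d == c]eq_sym.
  have := @quad_orthogonal0 (e_ a + e_ c) (e_ b + e_ d) (e_ a - e_ c) (e_ b - e_ d).
  rewrite D1 !D2 !B3 !B4 !quad_delta (eD a c ac) (eD b d bd) (eB a c ac) (eB b d bd).
  rewrite !(dotBl, dotBr, dotDl, dotDr) !ee !eqxx.
  rewrite !(negbTE ab, negbTE ac, negbTE ad, negbTE bc, negbTE bd, negbTE cd).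
  rewrite !(negbTE ba, negbTE ca, negbTE da, negbTE cb, negbTE db, negbTE dc).
  have share0' p q r s : uniq [:: p; q; r; s] -> W p q r q = 0.
    rewrite uniq4E => /and5P[pq pr ps qr /andP[qs rs]].
    rewrite h12 h34 opprK; apply: (share0 q p s r).
    by rewrite uniq4E (eq_sym q p) pq qs qr ps pr (eq_sym s r) rs.
  have uabcd : uniq [:: a; b; c; d] by rewrite uniq4E ab ac ad bc bd cd.
  have uadcb : uniq [:: a; d; c; b] by rewrite uniq4E ad ac ab dc db cb.
  have ucbad : uniq [:: c; b; a; d] by rewrite uniq4E cb ca cd ba bd ad.
  have ucdab : uniq [:: c; d; a; b] by rewrite uniq4E cd ca cb da db ab.
  rewrite !(share0 _ _ _ _ uabcd, share0 _ _ _ _ uadcb, share0 _ _ _ _ ucbad,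
    share0 _ _ _ _ ucdab, share0' _ _ _ _ uabcd, share0' _ _ _ _ uadcb,
    share0' _ _ _ _ ucbad, share0' _ _ _ _ ucdab, distinct0 _ _ _ _ uabcd,
    distinct0 _ _ _ _ uadcb, distinct0 _ _ _ _ ucbad, distinct0 _ _ _ _ ucdab).
  set K1 := W a b a b; set K2 := W a d a d; set K3 := W c b c b; set K4 := W c d c d.
  by move=> H; apply: (etrans _ (H _ _ _ _ _ _ _ _ _ _)); rewrite //= ?mulr0n ?mulr1n; lra.
pose K a b := W a b a b.
have KC a b : K a b = K b a by rewrite /K h12 h34 opprK.
(* The four traces make complementary pairs equal, K_ab = K_cd, and give K_ab + K_ac + K_ad = 0; the
   two double rotations then equate these three summands. *)
have K0 a b c d : uniq [:: a; b; c; d] -> K a b = 0.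
  move=> abcd; have := abcd; rewrite uniq4E => /and5P[ab ac ad bc /andP[bd cd]].
  have [db dc] : d != b /\ d != c by rewrite ![d == _]eq_sym.
  have abdc : uniq [:: a; b; d; c] by rewrite uniq4E ab ad ac bd bc dc.
  have acbd : uniq [:: a; c; b; d] by rewrite uniq4E ac ab ad eq_sym bc cd bd.
  have tr (p : 'I_4) := etrans (esym (sum_uniq4 (fun q => W q p q p) abcd)) (ht p p).
  have := double_frame _ _ _ _ abcd; have := double_frame _ _ _ _ abdc.
  have := tr a; have := tr b; have := tr c; have := tr d.
  have := KC b a; have := KC c a; have := KC c b; have := KC d a; have := KC d b.
  have := KC d c; rewrite !diag0 /K; lra.
have fresh (s : seq 'I_4) : (size s < 4)%N -> exists p, p \notin s.
  move=> s4; apply/existsP; rewrite -negb_forall; apply: contraL s4 => /forallP s4.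
  rewrite -leqNgt -[X in (X <= _)%N](card_ord 4) cardE.
  by apply: uniq_leq_size; [exact: enum_uniq | move=> x _; exact: s4].
have share a b d : a != b -> a != d -> b != d -> W a b a d = 0.
  move=> ab ad bd; have [c] := fresh [:: a; b; d] isT.
  rewrite !inE !negb_or => /and3P[ca cb cd]; apply: (share0 a b c d).
  by rewrite uniq4E ab ad bd ![_ == c]eq_sym ca cb cd.
have K00 a b : a != b -> W a b a b = 0.
  move=> ab; have [c] := fresh [:: a; b] isT; rewrite !inE negb_or => /andP[ca cb].
  have [d] := fresh [:: a; b; c] isT; rewrite !inE !negb_or => /and3P[da db dc].
  apply: (K0 a b c d).
  by rewrite uniq4E ab (eq_sym a c) (eq_sym b c) ![_ == d]eq_sym ca cb da db dc.
have [-> //|ij] := eqVneq i j; have [-> //|kl] := eqVneq k l.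
have [ki|ki] := eqVneq k i.
  rewrite ki in kl *; have [-> |lj] := eqVneq l j; first exact: K00.
  by apply: share; rewrite // eq_sym.
have [kj|kj] := eqVneq k j.
  rewrite kj in kl *; have [-> |li] := eqVneq l i; first by rewrite h12 K00 ?oppr0 // eq_sym.
  by rewrite h12 share ?oppr0 // eq_sym.
have [-> |li] := eqVneq l i; first by rewrite h34 share ?oppr0 // eq_sym.
have [-> |lj] := eqVneq l j; first by rewrite h12 h34 opprK share // eq_sym.
by apply: distinct0; rewrite uniq4E ij kl (eq_sym i k) (eq_sym j k) ![_ == l]eq_sym ki kj li lj.
Qed.

End WeylVanishing.

(** * Asymptotics of the induced metrics *)

Section EuclideanNorm.
Variable R : realType.
Implicit Types (x y : E4 R).

Lemma enorm_ge0 x : 0 <= enorm x.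
Proof. exact: sqrtr_ge0. Qed.

Lemma enorm_sqr x : enorm x ^+ 2 = dot x x.
Proof. by rewrite /enorm sqr_sqrtr ?dot_ge0. Qed.

Lemma enormZ_unit (r : R) x : 0 <= r -> dot x x = 1 -> enorm (r *: x) = r.
Proof. by move=> r0 xx; rewrite /enorm dotZl dotZr xx mulr1 -expr2 sqrtr_sqr ger0_norm. Qed.

Lemma smooth_dot_self (U : set (E4 R)) : open U -> smooth_on U (fun x => dot x x : R^o).
Proof.
move=> oU; apply: (smooth_sum oU) => i.
by apply: (smoothM oU); exact: (smooth_coord oU).
Qed.

Lemma open_exterior (r : R) : 0 <= r -> open [set x | r < enorm x].
Proof.
move=> r0.
rewrite (_ : [set x | _] = (fun x => dot x x) @^-1` [set z : R | r ^+ 2 < z]).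
  apply: open_comp; last exact: open_gt.
  by move=> x _; have [] := smooth_dot_self openT [::] (x := x) Logic.I.
by apply/seteqP; split => x /=; rewrite -enorm_sqr ltr_pXn2r ?nnegrE ?enorm_ge0.
Qed.

Lemma smooth_dot_inv (U : set (E4 R)) : open U -> (forall x, U x -> dot x x != 0) ->
  smooth_on U (fun x => (dot x x)^-1 : R^o).
Proof.
move=> oU U0; apply: (smooth_alg_on oU).
have sd := smooth_dot_self oU.
apply: (@alg_ode _ _ _ (fun i x => - pd [:: i] (fun y => dot y y : R^o) x) 2).
- move=> x Ux; apply: differentiable_continuous.
  exact: (differentiableV (smooth_differentiable oU sd Ux) (U0 x Ux)).
- move=> i; have -> : (fun x => - pd [:: i] (fun y => dot y y : R^o) x) =
      (fun x => -1 * pd [:: i] (fun y => dot y y : R^o) x).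
    by apply/funext => x; rewrite mulN1r.
  by apply: (smoothZ oU); exact: smooth_pd.
- move=> i x Ux; have [dx _] := smooth_is_derive i sd Ux.
  pose d (y : E4 R) : R^o := dot y y.
  have dV := DeriveDef (@derivableV _ _ d x _ (U0 x Ux) dx) (@deriveV _ _ d x _ (U0 x Ux) dx).
  apply: (is_derive_eq dV); rewrite /= exprVn scaleNr mulNr.
  by congr (- _); exact: mulrC.
Qed.

Lemma smooth_homogeneous (U : set (E4 R)) (c : 'I_4 -> 'I_4 -> R) :
  open U -> (forall x, U x -> dot x x != 0) ->
  smooth_on U (fun x => \sum_k \sum_l c k l * (x 0 k * x 0 l / enorm x ^+ 4) : R^o).
Proof.
move=> oU U0; apply: (smooth_sum oU) => k; apply: (smooth_sum oU) => l.
(* The fourth power of the norm is the square of [dot x x], so no square root has to be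
   differentiated. *)
have -> : (fun x => c k l * (x 0 k * x 0 l / enorm x ^+ 4) : R^o) =
  (fun x => c k l * ((x 0 k * x 0 l) * ((dot x x)^-1 * (dot x x)^-1))).
  apply/funext => x; rewrite -invfM -expr2 -enorm_sqr -exprM //.
apply: (smoothZ oU); have sI := smooth_dot_inv oU U0.
exact: (smoothM oU (smoothM oU (smooth_coord oU k) (smooth_coord oU l)) (smoothM oU sI sI)).
Qed.

End EuclideanNorm.

Lemma smooth_sphere_frame (R : realType) (Q : 'M[R]_4) i a :
  smooth_on (@chart_ball R) (fun u => sphere_frame Q i u 0 a : R^o).
Proof.
have oB := @open_chart_ball R.
have -> : (fun u => sphere_frame Q i u 0 a : R^o) =
    (fun u => \sum_p ceval (cderive i (graph_coord p)) u * Q p a).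
  by apply/funext => y; rewrite mxE; apply: eq_bigr => p _; rewrite mxE.
apply: (smooth_sum oB) => p; apply: (smoothM oB); first exact: smooth_ceval.
exact: (smooth_cst oB).
Qed.

(** * Decay of the remainder after rescaling to the unit sphere *)

Section RescaledRemainder.
Variables (R : realType) (Q : 'M[R]_4) (QQ : Q *m Q^T = 1%:M).
Variables (R0 s : R) (R0_gt0 : 0 < R0) (h : E4 R -> R^o).
Hypothesis sh : smooth_on [set x | R0 < enorm x] h.
Local Notation B := (@chart_ball R).

(** The weight [r ^+ size b] exactly offsets the additional decay that [bigO_oo] grants to
    [pd b h]. *)
Definition rescaled (b : seq 'I_4) (r : R) (u : E4 R) : R^o :=
  r ^+ size b * pd b h (r *: sphere_chart Q u).

(* The functions obtained by differentiating u |-> h (r phi(u)): each derivative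
   falling on h brings out a factor r, so they all have the size of h. *)
Inductive rescaled_family : (R -> E4 R -> R^o) -> Prop :=
| family_rescaled b : rescaled_family (rescaled b)
| family_add F G : rescaled_family F -> rescaled_family G ->
    rescaled_family (fun r u => F r u + G r u)
| family_mul (c : E4 R -> R^o) F : smooth_on B c -> rescaled_family F ->
    rescaled_family (fun r u => c u * F r u).

Lemma family_sum (I : Type) (t : seq I) (F : I -> R -> E4 R -> R^o) :
  (forall i, rescaled_family (F i)) -> rescaled_family (fun r u => \sum_(i <- t) F i r u).
Proof.
move=> fF; elim: t => [|i t IH].
  under eq_fun do under eq_fun do rewrite big_nil.
  have := family_mul (smooth_cst (open_chart_ball (R := R)) 0) (family_rescaled [::]).
  by under eq_fun do under eq_fun do rewrite mul0r.
under eq_fun do under eq_fun do rewrite big_cons.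
exact: family_add.
Qed.

Lemma scaled_chart_exterior r u : R0 < r -> B u -> R0 < enorm (r *: sphere_chart Q u).
Proof.
move=> r0 Bu; rewrite enormZ_unit ?sphere_chart_unit //.
exact: ltW (lt_trans R0_gt0 r0).
Qed.

Lemma scaled_chart_row r u :
  \row_a (r * sphere_chart Q u 0 a) = r *: sphere_chart Q u.
Proof. by apply/rowP => a; rewrite !mxE. Qed.

Lemma smooth_scaled_chart r a : smooth_on B (fun u => r * sphere_chart Q u 0 a : R^o).
Proof. apply: (smoothZ (open_chart_ball (R := R))); exact: smooth_sphere_chart. Qed.

Lemma smooth_comp_scaled_chart (V U : set (E4 R)) (k : E4 R -> R^o) r :
  open V -> smooth_on V k -> open U -> U `<=` B ->
  (forall u, U u -> V (r *: sphere_chart Q u)) ->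
  smooth_on U (fun u => k (r *: sphere_chart Q u)).
Proof.
move=> oV sk oU UB UV.
have -> : (fun u => k (r *: sphere_chart Q u)) =
    (fun u => k (\row_a (r * sphere_chart Q u 0 a))).
  by apply/funext => u; rewrite scaled_chart_row.
apply: (smooth_comp oU oV sk) => [a|u Uu]; last by rewrite scaled_chart_row; exact: UV.
by move=> t u Uu; exact: (smooth_scaled_chart r a t (UB u Uu)).
Qed.

Lemma dpd_comp_scaled_chart (V : set (E4 R)) (k : E4 R -> R^o) r i u :
  open V -> smooth_on V k -> B u -> V (r *: sphere_chart Q u) ->
  dpd [:: i] (fun y => k (r *: sphere_chart Q y)) u =
  \sum_a (r * sphere_frame Q i u 0 a) * pd [:: a] k (r *: sphere_chart Q u).
Proof.
move=> oV sk Bu Vu; have oB := @open_chart_ball R.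
have -> : (fun u => k (r *: sphere_chart Q u)) =
    (fun u => k (\row_a (r * sphere_chart Q u 0 a))).
  by apply/funext => y; rewrite scaled_chart_row.
have dphi a : differentiable (fun u => r * sphere_chart Q u 0 a : R^o) u.
  exact: (smooth_differentiable oB (smooth_scaled_chart r a) Bu).
have dk : differentiable k (\row_a (r * sphere_chart Q u 0 a)).
  by rewrite scaled_chart_row; exact: (smooth_differentiable oV sk Vu).
have [_] := is_derive_comp (delta_mx 0 (lift ord0 i)) dphi dk.
rewrite dpd.unlock /= => ->; rewrite scaled_chart_row.
apply: eq_bigr => a _; congr (_ * _).
rewrite -(dpd_sphere_chart Q i a Bu) -(dpdZ oB) //; last exact: smooth_sphere_chart.
by rewrite dpd.unlock.
Qed.

(** The witness [G] is chosen before [r], so that one constant will serve all large radii. *)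
Lemma rescaled_family_derive F i : rescaled_family F ->
  exists2 G, rescaled_family G & forall r, R0 < r ->
    smooth_on B (F r) /\ forall u, B u -> dpd [:: i] (F r) u = G r u.
Proof.
have oB := @open_chart_ball R.
have oE : open [set x : E4 R | R0 < enorm x] by apply: open_exterior; exact: ltW.
elim=> {F} [b|F F' fF [G fG dG] fF' [G' fG' dG']|c F sc fF [G fG dG]].
- exists (fun r u => \sum_a sphere_frame Q i u 0 a * rescaled (a :: b) r u).
    apply: family_sum => a; apply: family_mul (family_rescaled _).
    exact: smooth_sphere_frame.
  move=> r Rr; have sb := smooth_pd b sh.
  have ext u : B u -> R0 < enorm (r *: sphere_chart Q u) by exact: scaled_chart_exterior.
  have sc := smooth_comp_scaled_chart oE sb oB (@subset_refl _ B) ext.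
  split=> [|u Bu]; first exact: (smoothZ oB).
  rewrite (dpdZ oB [:: i] _ sc Bu) (dpd_comp_scaled_chart i oE sb Bu (ext u Bu)) mulr_sumr.
  by apply: eq_bigr => a _; rewrite /rescaled /= exprS; ring.
- exists (fun r u => G r u + G' r u); first exact: family_add.
  move=> r Rr; have [sF dF] := dG r Rr; have [sF' dF'] := dG' r Rr.
  split=> [|u Bu]; first exact: (smoothD oB).
  by rewrite (dpdD oB [:: i] sF sF' Bu) dF // dF'.
- exists (fun r u => dpd [:: i] c u * F r u + c u * G r u).
    exact: (family_add (family_mul (smooth_dpd [:: i] sc) fF) (family_mul sc fG)).
  move=> r Rr; have [sF dF] := dG r Rr.
  split=> [|u Bu]; first exact: (smoothM oB).
  by rewrite (dpd1M i sc sF Bu) dF.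
Qed.

Lemma smooth_rescaled_family F r : rescaled_family F -> R0 < r -> smooth_on B (F r).
Proof. by move=> /(rescaled_family_derive ord0) [G _ H] /H []. Qed.

Lemma rescaled_family_dpd F b : rescaled_family F ->
  exists2 G, rescaled_family G & forall r u, R0 < r -> B u -> dpd b (F r) u = G r u.
Proof.
move=> fF; elim: b => [|i b [G fG dG]]; first by exists F => // r u _ _; rewrite dpd.unlock.
have [G' fG' dG'] := rescaled_family_derive i fG.
exists G' => // r u Rr Bu; have [_ <-] // := dG' r Rr.
rewrite dpd_cons; apply: (dpd_eq_on (@open_chart_ball R) [:: i] _ Bu) => y By.
exact: dG.
Qed.

Hypothesis decay : bigO_oo s h.

Lemma rescaled_family_bound F : rescaled_family F ->
  exists C r0 : R, forall r, r0 < r -> `|F r 0| <= C * r `^ (- s).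
Proof.
have B0 := @chart_ball0 R.
elim=> {F} [b|F G _ [C [r0 HF]] _ [C' [r0' HG]]|c F _ _ [C [r0 HF]]].
- have [C [r0 H]] := decay b; exists C, (Num.max r0 0) => r.
  rewrite gt_max => /andP[rr r_gt0].
  have en : enorm (r *: sphere_chart Q 0) = r.
    by rewrite enormZ_unit ?sphere_chart_unit // ltW.
  have := H (r *: sphere_chart Q 0); rewrite en => /(_ rr) Hr.
  rewrite /rescaled normrM ger0_norm ?exprn_ge0 ?(ltW r_gt0) //.
  apply: le_trans (ler_wpM2l _ Hr) _; first by rewrite exprn_ge0 // ltW.
  rewrite mulrCA -powR_mulrn ?(ltW r_gt0) // -powRD ?(gt_eqF r_gt0) ?implybT //.
  by rewrite addrCA subrr addr0.
- exists (C + C'), (Num.max r0 r0') => r; rewrite gt_max => /andP[/HF hF /HG hG].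
  by rewrite mulrDl; apply: le_trans (ler_normD _ _) _; exact: lerD.
- exists (`|c 0| * C), r0 => r /HF hF.
  by rewrite normrM -mulrA ler_wpM2l.
Qed.

Lemma rescaled_family_decay F b : rescaled_family F ->
  exists C r0 : R, forall r, r0 < r -> `|dpd b (F r) 0| <= C * r `^ (- s).
Proof.
move=> /(rescaled_family_dpd b) [G fG dG].
have [C [r0 H]] := rescaled_family_bound fG.
exists C, (Num.max r0 R0) => r; rewrite gt_max => /andP[rr Rr].
by rewrite dG ?H //; exact: chart_ball0.
Qed.

End RescaledRemainder.

Section Components.
Variables (R : realType) (V : set (E4 R)) (oV : open V) (F : E4 R -> E4 R).
Hypothesis sF : smooth_on V F.

Lemma pd_component s al x : V x ->
  pd s (fun y => F y 0 al : R^o) x = pd s F x 0 al.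
Proof.
elim: s x => [//|i s IH] x Vx /=.
rewrite (near_eq_derive _ (near_open oV Vx IH)).
have [_ dF] := sF s Vx.
by rewrite derive_mx ?mxE //; exact: dF.
Qed.

Lemma smooth_component al : smooth_on V (fun y => F y 0 al : R^o).
Proof.
move=> s x Vx; have [cF dF] := sF s Vx.
have near_comp : {near x, (fun y => pd s F y 0 al : R^o) =1 pd s (fun y => F y 0 al : R^o)}.
  by apply: (near_open oV Vx) => y Vy; rewrite pd_component.
split; last first.
  move=> i; apply: near_eq_derivable near_comp _.
  by have /derivable_mxP := dF i; apply.
change (pd s (fun y => F y 0 al : R^o) @ x --> pd s (fun y => F y 0 al : R^o) x).
rewrite pd_component //; apply: cvg_trans (near_eq_cvg near_comp) _.
exact: (@continuous_comp _ _ _ (pd s F) (fun M : E4 R => M 0 al) x cF (@coord_continuous _ _ _ _ _ _)).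
Qed.

Lemma derive_component al v x : V x ->
  'D_v (fun y => F y 0 al : R^o) x = 'D_v F x 0 al.
Proof.
move=> Vx.
have dF : derivable F x v.
  apply/derivable_mxP => i j; rewrite (ord1 i); apply: diff_derivable.
  exact: (smooth_differentiable oV (smooth_component j) Vx).
by rewrite derive_mx // mxE.
Qed.

End Components.

(** * A local isometric embedding read in the chart *)

Section EmbeddedSphere.
Variables (R : realType) (Q : 'M[R]_4) (QQ : Q *m Q^T = 1%:M).
Local Notation B := (@chart_ball R).

(** This is r^-2 sigma_r: the coordinate vectors of u |-> r phi(u) are r times the frame vectors,
    and the two factors r are divided out. *)
Definition sphere_metric (g : metric_field R) (r : R) (i j : 'I_3) (u : E4 R) : R^o :=
  inner g (r *: sphere_chart Q u) (sphere_frame Q i u) (sphere_frame Q j u).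

Variables (g : metric_field R) (r : R) (r_gt0 : 0 < r).
Variables (V : set (E4 R)) (oV : open V) (F : E4 R -> E4 R).
Hypothesis sF : smooth_on V F.
Hypothesis isometric : forall x X Y, V x -> enorm x = r -> dot X x = 0 -> dot Y x = 0 ->
  dot ('D_X F x) ('D_Y F x) = inner g x X Y.

Let U : set (E4 R) := B `&` [set u | V (r *: sphere_chart Q u)].

Lemma open_chart_preimage : open U.
Proof.
have oB := @open_chart_ball R.
rewrite openE => u [Bu Vu].
have cphi : {for u, continuous (fun y => \row_a (r * sphere_chart Q y 0 a))}.
  apply: differentiable_continuous; apply: differentiable_row => a.
  exact: (smooth_differentiable oB (smooth_scaled_chart Q r a) Bu).
have nV : nbhs (\row_a (r * sphere_chart Q u 0 a)) V.
  by rewrite scaled_chart_row; exact: open_nbhs_nbhs (conj oV Vu).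
have nB : nbhs u B := open_nbhs_nbhs (conj oB Bu).
apply: filterS (filterI nB (cphi _ nV)) => y [By]; rewrite /= scaled_chart_row => Vy.
by split.
Qed.

(** The factor [r^-1] matches the rescaling of the metric. *)
Let f (al : 'I_4) (u : E4 R) : R^o := r^-1 * F (r *: sphere_chart Q u) 0 al.

Let smooth_F_chart al : smooth_on U (fun u => F (r *: sphere_chart Q u) 0 al : R^o).
Proof.
apply: (smooth_comp_scaled_chart oV (smooth_component oV sF al) open_chart_preimage).
- by move=> u [].
- by move=> u [].
Qed.

Let smooth_f al : smooth_on U (f al).
Proof. exact: (smoothZ open_chart_preimage). Qed.

Lemma jet1_embedding i u : U u -> jet f [:: i] u = 'D_(sphere_frame Q i u) F (r *: sphere_chart Q u).
Proof.
move=> Uu; have [Bu Vu] := Uu; apply/rowP => al; rewrite jetE.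
rewrite (dpdZ open_chart_preimage [:: i] _ (smooth_F_chart al) Uu).
rewrite (dpd_comp_scaled_chart i oV (smooth_component oV sF al) Bu Vu).
rewrite -(derive_component oV sF al _ Vu).
rewrite (derive_gradient _ (smooth_differentiable oV (smooth_component oV sF al) Vu)).
rewrite mulr_sumr; apply: eq_bigr => a _.
by rewrite !mulrA mulVf ?gt_eqF // mul1r.
Qed.

Lemma sphere_metric_embedding i j u : U u ->
  sphere_metric g r i j u = dot (jet f [:: i] u) (jet f [:: j] u).
Proof.
move=> Uu; have [Bu Vu] := Uu; rewrite !jet1_embedding // isometric //.
- by rewrite enormZ_unit ?sphere_chart_unit // ltW.
- by rewrite dotZr sphere_frame_tangent // mulr0.
- by rewrite dotZr sphere_frame_tangent // mulr0.
Qed.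

Hypothesis smooth_metric : forall i j, smooth_on B (sphere_metric g r i j).
Hypothesis V0 : V (r *: sphere_chart Q 0).

Lemma embedded_obstruction (eta : R) : eta <= (1000 * 1000)^-1 ->
  (forall i j, `|sphere_metric g r i j 0 - (i == j)%:R| <= eta) ->
  (forall k i j, `|dpd [:: k] (sphere_metric g r i j) 0| <= eta) ->
  (forall l k i j, `|dpd [:: l; k] (sphere_metric g r i j) 0
    - ((l == i)%:R * (k == j)%:R + (l == j)%:R * (k == i)%:R)| <= eta) ->
  (forall m l k i j, `|dpd [:: m; l; k] (sphere_metric g r i j) 0| <= eta) ->
  `|obstruction (sphere_metric g r) 0| <= 2400 * 1000 * (eta * eta).
Proof.
move=> eta1 h0 h1 h2 h3.
apply: (obstruction_quadratic open_chart_preimage smooth_f _ sphere_metric_embedding) => //.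
- by move=> i j t u [Bu _]; exact: (smooth_metric i j t Bu).
- by split => //; exact: chart_ball0.
Qed.

End EmbeddedSphere.

Section UniformBounds.
Variable R : realType.

Lemma uniform_bound (I : finType) (X : I -> R -> R) (Y : R -> R) :
  (forall r, 0 <= Y r) ->
  (forall t, exists C r0 : R, forall r, r0 < r -> X t r <= C * Y r) ->
  exists C r0 : R, 0 <= C /\ forall r, r0 < r -> forall t, X t r <= C * Y r.
Proof.
move=> Y0 H.
have [c Hc] := choice H; have [r0 Hr] := choice Hc.
exists (\sum_t `|c t|), (\sum_t `|r0 t|); split; first by apply: sumr_ge0.
have le_sum (k : I -> R) t : k t <= \sum_t `|k t|.
  rewrite (bigD1 t) //= (le_trans (ler_norm _)) // lerDl.
  by apply: sumr_ge0.
move=> r rr t; apply: le_trans (Hr t r _) _; first exact: le_lt_trans (le_sum r0 t) rr.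
by apply: ler_wpM2r => //; exact: le_sum.
Qed.

Lemma sum_bound (I : finType) (X : I -> R -> R) (Y : R -> R) :
  (forall r, 0 <= Y r) ->
  (forall t, exists C r0 : R, forall r, r0 < r -> `|X t r| <= C * Y r) ->
  exists C r0 : R, forall r, r0 < r -> `|\sum_t X t r| <= C * Y r.
Proof.
move=> Y0 /(uniform_bound Y0)[C [r0 [_ H]]].
exists (C *+ #|I|), r0 => r rr; apply: le_trans (ler_norm_sum _ _ _) _.
rewrite mulrnAl -sumr_const; apply: ler_sum => t _; exact: H.
Qed.

Lemma powR_decay (s e : R) : 0 < s -> 0 < e ->
  exists r0 : R, forall r, r0 < r -> r `^ (- s) < e.
Proof.
move=> s0 e0; exists (e^-1 `^ s^-1) => r rr.
have r0 : 0 < r by apply: le_lt_trans rr; exact: powR_ge0.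
rewrite powRN invf_plt ?posrE ?powR_gt0 //.
have := gt0_ltr_powR s0; move=> /(_ (e^-1 `^ s^-1) r).
rewrite !nnegrE powR_ge0 (ltW r0) => /(_ isT isT rr).
by rewrite -powRrM mulVf ?gt_eqF // powRr1 // invr_ge0 ltW.
Qed.

End UniformBounds.

(** * Expansion of the rescaled metric and comparison of the two orders *)

Section Expansion.
Local Notation o1 := (@Ordinal 3 0 isT).
Local Notation o2 := (@Ordinal 3 1 isT).
Local Notation o3 := (@Ordinal 3 2 isT).
Variables (R : realType) (Q : 'M[R]_4) (QQ : Q *m Q^T = 1%:M).
Variables (g : metric_field R) (R0 eps lam : R) (W : tensor4 R) (Xi : R -> tensor4 R).
Hypotheses (R0_gt0 : 0 < R0) (eps_gt0 : 0 < eps).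
Hypothesis sg : forall a b, smooth_on [set x | R0 < enorm x] (fun x => g x a b : R^o).
Hypothesis hXi : mass_tensor Xi.
Local Notation B := (@chart_ball R).

Definition metric_remainder (a b : 'I_4) (x : E4 R) : R^o :=
  g x a b - (a == b)%:R -
  \sum_k \sum_l (W a k l b + Xi lam a b k l) * (x 0 k * x 0 l / enorm x ^+ 4).

Hypothesis decay : forall a b, bigO_oo (2 + eps) (metric_remainder a b).

Definition chart_remainder (r : R) (i j : 'I_3) (u : E4 R) : R^o :=
  \sum_a \sum_b (sphere_frame Q i u 0 a * sphere_frame Q j u 0 b) *
    rescaled Q (metric_remainder a b) [::] r u.

Definition weyl_part (i j : 'I_3) (u : E4 R) : R^o :=
  quad W (sphere_frame Q i u) (sphere_chart Q u) (sphere_chart Q u) (sphere_frame Q j u).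

Lemma smooth_metric_remainder a b :
  smooth_on [set x | R0 < enorm x] (metric_remainder a b).
Proof.
have oE : open [set x : E4 R | R0 < enorm x] by apply: open_exterior; exact: ltW.
apply: (smoothB oE); first exact: (smoothB oE (sg a b) (smooth_cst oE _)).
apply: (smooth_homogeneous (fun k l => W a k l b + Xi lam a b k l) oE) => x /= Rx.
by rewrite -enorm_sqr expf_neq0 // gt_eqF // (lt_trans R0_gt0).
Qed.

(** The frame vectors are tangent to the sphere, where the mass tensor acts as -lam / 9 times the
    round metric. The factor r^-2 is what remains of x_k x_l / |x|^4 on the sphere of radius r. *)
Lemma sphere_metric_expansion r i j u : R0 < r -> B u ->
  sphere_metric Q g r i j u =
  ceval (round_expr i j) u
  + r ^- 2 * (weyl_part i j u - lam / 9 * ceval (round_expr i j) u)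
  + chart_remainder r i j u.
Proof.
move=> Rr Bu; have r0 : 0 < r := lt_trans R0_gt0 Rr.
set w := sphere_chart Q u; set X := sphere_frame Q i u; set Y := sphere_frame Q j u.
have ww : dot w w = 1 by exact: sphere_chart_unit.
have w1 : enorm w = 1 by rewrite /enorm ww sqrtr1.
have Xw : dot X w = 0 by exact: sphere_frame_tangent.
have Yw : dot Y w = 0 by exact: sphere_frame_tangent.
have XY : dot X Y = ceval (round_expr i j) u by exact: dot_sphere_frame.
have en : enorm (r *: w) = r by rewrite enormZ_unit // ltW.
have hx := hXi lam w1 Xw Yw.
rewrite -XY /weyl_part -/w -/X -/Y /sphere_metric -/w -/X -/Y.
have -> : chart_remainder r i j u = inner g (r *: w) X Y - dot X Y -
   r ^- 2 * (quad W X w w Y + \sum_a \sum_b \sum_k \sum_l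
      Xi lam a b k l * X 0 a * Y 0 b * w 0 k * w 0 l).
  have -> : dot X Y = \sum_a \sum_b (a == b)%:R * X 0 a * Y 0 b.
    apply: eq_bigr => a _; rewrite (bigD1 a) //= eqxx mul1r big1 ?addr0 // => b ba.
    by rewrite eq_sym (negbTE ba) !mul0r.
  have -> : quad W X w w Y = \sum_a \sum_b \sum_k \sum_l W a k l b * X 0 a * Y 0 b * w 0 k * w 0 l.
    apply: eq_bigr => a _; under eq_bigr do rewrite exchange_big.
    rewrite exchange_big; apply: eq_bigr => b _; do 2!(apply: eq_bigr => ? _).
    by rewrite -/w -/Y; ring.
  rewrite -big_split mulr_sumr /inner -!sumrB; apply: eq_bigr => a _.
  rewrite -big_split mulr_sumr -!sumrB; apply: eq_bigr => b _ /=.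
  rewrite /rescaled /= expr0 mul1r /metric_remainder en -/w -/X -/Y.
  rewrite -big_split !mulr_sumr !mulrBr; congr (_ - _ - _); [by ring | by ring |].
  rewrite mulr_sumr; apply: eq_bigr => k _.
  rewrite -big_split !mulr_sumr; apply: eq_bigr => l _ /=.
  by rewrite !mxE; field; rewrite gt_eqF.
by rewrite hx; ring.
Qed.

Lemma family_chart_remainder_term i j a b :
  rescaled_family Q (metric_remainder a b) (fun r u =>
    (sphere_frame Q i u 0 a * sphere_frame Q j u 0 b) *
    rescaled Q (metric_remainder a b) [::] r u).
Proof.
apply: (family_mul _ (family_rescaled Q (metric_remainder a b) [::])).
exact: (smoothM (@open_chart_ball R) (smooth_sphere_frame Q i a) (smooth_sphere_frame Q j b)).
Qed.

Let smooth_term r i j a b (Rr : R0 < r) := smooth_rescaled_family QQ R0_gt0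
  (smooth_metric_remainder a b) (family_chart_remainder_term i j a b) Rr.

Lemma smooth_chart_remainder r i j : R0 < r -> smooth_on B (chart_remainder r i j).
Proof.
move=> Rr; have oB := @open_chart_ball R.
by apply: (smooth_sum oB) => a; apply: (smooth_sum oB) => b; exact: smooth_term.
Qed.

Lemma chart_remainder_decay s i j : exists C r0 : R, forall r, r0 < r ->
  `|dpd s (chart_remainder r i j) 0| <= C * r `^ (- (2 + eps)).
Proof.
have oB := @open_chart_ball R; have B0 := @chart_ball0 R.
pose term (t : 'I_4 * 'I_4) r := dpd s (fun u =>
    (sphere_frame Q i u 0 t.1 * sphere_frame Q j u 0 t.2) *
    rescaled Q (metric_remainder t.1 t.2) [::] r u) 0 : R.
have [|t|C [r0 H]] := @sum_bound R _ term (fun r => r `^ (- (2 + eps))).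
- by move=> r; exact: powR_ge0.
- exact: (rescaled_family_decay QQ R0_gt0 (smooth_metric_remainder t.1 t.2)
    (@decay t.1 t.2) s (family_chart_remainder_term i j t.1 t.2)).
exists C, (Num.max r0 R0) => r; rewrite gt_max => /andP[rr Rr].
have := H r rr; rewrite /term -(pair_bigA _ (fun a b => dpd s (fun u =>
    (sphere_frame Q i u 0 a * sphere_frame Q j u 0 b) *
    rescaled Q (metric_remainder a b) [::] r u) 0)) /=.
congr (`|_| <= _); rewrite (dpd_sum oB); last exact: B0.
  apply: eq_bigr => a _; rewrite (dpd_sum oB) //.
  by move=> b; exact: smooth_term.
by move=> a; apply: (smooth_sum oB) => b; exact: smooth_term.
Qed.

Lemma smooth_weyl_part i j : smooth_on B (weyl_part i j).
Proof.
have oB := @open_chart_ball R.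
have -> : weyl_part i j = (fun u => \sum_(t : 'I_4 * 'I_4 * 'I_4 * 'I_4)
    quad W (row t.1.1.1 Q) (row t.1.1.2 Q) (row t.1.2 Q) (row t.2 Q) *
    ceval (weyl_expr t i j) u).
  apply/funext => u; rewrite /weyl_part quad_mulmx.
  by apply: eq_bigr => t _; rewrite !mxE.
by apply: (smooth_sum oB) => t; apply: (smoothZ oB); exact: smooth_ceval.
Qed.

Lemma smooth_sphere_metric r i j : R0 < r -> smooth_on B (sphere_metric Q g r i j).
Proof.
move=> Rr; have oB := @open_chart_ball R.
have oE : open [set x : E4 R | R0 < enorm x] by apply: open_exterior; exact: ltW.
apply: (smooth_sum oB) => a; apply: (smooth_sum oB) => b.
apply: (smoothM oB); last exact: smooth_sphere_frame.
apply: (smoothM oB); last exact: smooth_sphere_frame.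
apply: (smooth_comp_scaled_chart oE (sg a b) oB) => // u Bu.
exact: (scaled_chart_exterior QQ R0_gt0 Rr Bu).
Qed.

Lemma sphere_metric_jet r s i j : R0 < r ->
  dpd s (sphere_metric Q g r i j) 0 =
  (ceval0 (foldr cderive (round_expr i j) s))%:~R
  + r ^- 2 * (dpd s (weyl_part i j) 0
      - lam / 9 * (ceval0 (foldr cderive (round_expr i j) s))%:~R)
  + dpd s (chart_remainder r i j) 0.
Proof.
move=> Rr; have oB := @open_chart_ball R; have B0 := @chart_ball0 R.
have sr : smooth_on B (ceval (round_expr i j)) by exact: smooth_ceval.
have sr9 := smoothZ oB (lam / 9) sr.
have sw := smooth_weyl_part i j.
have s1 := smoothZ oB (r ^- 2) (smoothB oB sw sr9).
rewrite (dpd_eq_on oB s (fun u => @sphere_metric_expansion r i j u Rr) B0).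
rewrite (dpdD oB s (smoothD oB sr s1) (smooth_chart_remainder i j Rr) B0).
rewrite (dpdD oB s sr s1 B0) (dpdZ oB s _ (smoothB oB sw sr9) B0).
by rewrite (dpdB oB s sw sr9 B0) (dpdZ oB s _ sr B0) dpd_ceval0.
Qed.

Lemma powR_split r : 0 < r -> r `^ (- (2 + eps)) = r ^- 2 * r `^ (- eps).
Proof.
move=> r0; rewrite opprD powRD ?(gt_eqF r0) ?implybT //.
by rewrite (powRN r 2) powR_mulrn // ltW.
Qed.

(** For r > 1 the remainder r^(-2-eps) is at most r^-2; one constant serves because there are
    finitely many indices and lists of length [n]. *)
Lemma sphere_metric_jets_close n : exists C r0 : R, 0 <= C /\ forall r, r0 < r ->
  forall s i j, size s = n -> `|dpd s (sphere_metric Q g r i j) 0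
    - (ceval0 (foldr cderive (round_expr i j) s))%:~R| <= C * r ^- 2.
Proof.
pose X (t : n.-tuple 'I_3 * 'I_3 * 'I_3) r := `|dpd t.1.1 (sphere_metric Q g r t.1.2 t.2) 0
    - (ceval0 (foldr cderive (round_expr t.1.2 t.2) t.1.1))%:~R| : R.
have [| |C [r0 [C0 H]]] := @uniform_bound R _ X (fun r => r ^- 2).
- by move=> r; rewrite invr_ge0 sqr_ge0.
- move=> [[s i] j]; have [C [r0 H]] := chart_remainder_decay s i j.
  exists (`|dpd s (weyl_part i j) 0
      - lam / 9 * (ceval0 (foldr cderive (round_expr i j) s))%:~R| + `|C|).
  exists (Num.max r0 (Num.max R0 1)) => r; rewrite !gt_max => /and3P[rr Rr r1].
  have r_gt0 := lt_trans R0_gt0 Rr.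
  have d0 : 0 <= r ^- 2 by rewrite invr_ge0 sqr_ge0.
  have cancel3 (x y z : R) : x + y + z - x = y + z by ring.
  rewrite /X /= sphere_metric_jet // cancel3 mulrDl.
  apply: le_trans (ler_normD _ _) _; apply: lerD.
    by rewrite normrM mulrC (ger0_norm d0).
  apply: le_trans (H r rr) _; rewrite (powR_split r_gt0).
  apply: (@le_trans _ _ (`|C| * (r ^- 2 * r `^ (- eps)))).
    by rewrite ler_wpM2r ?ler_norm // mulr_ge0 ?powR_ge0.
  rewrite ler_wpM2l // ler_piMr //.
  rewrite -(powRr0 r); apply: ler_powR; first exact: ltW.
  by rewrite oppr_le0 ltW.
exists C, r0; split => // r rr s i j sn.
by have := H r rr (tcast sn (in_tuple s), i, j); rewrite /X /= val_tcast.
Qed.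

Lemma obstruction_remainder_decay : exists C r0 : R, 0 <= C /\ forall r, r0 < r ->
  `|obstruction (chart_remainder r) 0| <= C * r `^ (- (2 + eps)).
Proof.
pose X (t : 3.-tuple 'I_3 * 'I_3 * 'I_3) r := `|dpd t.1.1 (chart_remainder r t.1.2 t.2) 0| : R.
have [| |C [r0 [C0 H]]] := @uniform_bound R _ X (fun r => r `^ (- (2 + eps))).
- by move=> r; exact: powR_ge0.
- by move=> [[s i] j]; exact: chart_remainder_decay.
exists (8 * C), r0; split; first by rewrite mulr_ge0.
move=> r rr; have {}H k l m i j : `|dpd [:: k; l; m] (chart_remainder r i j) 0| <=
    C * r `^ (- (2 + eps)) by exact: (H r rr ([tuple k; l; m], i, j)).
rewrite -mulrA; set e := C * _ in H *; rewrite /obstruction.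
have := H o3 o3 o1 o2 o3; have := H o3 o3 o3 o1 o2; have := H o3 o2 o1 o3 o3.
have := H o3 o2 o3 o1 o3; have := H o1 o1 o2 o3 o1; have := H o1 o1 o1 o2 o3.
have := H o1 o3 o2 o1 o1; have := H o1 o3 o1 o2 o1.
by rewrite !ler_norml; lra.
Qed.

Local Notation d0 := (@Ordinal 4 0 isT).
Local Notation d1 := (@Ordinal 4 1 isT).
Local Notation d2 := (@Ordinal 4 2 isT).
Local Notation d3 := (@Ordinal 4 3 isT).

(** [obstruction] consists of third derivatives, which vanish at 0 for the round metric; the round
    term and the mass term, a multiple of it, drop out together. *)
Lemma obstruction_sphere_metric r : algebraic_weyl W -> R0 < r ->
  obstruction (sphere_metric Q g r) 0 =
  r ^- 2 * (- 24 * quad W (row d0 Q) (row d2 Q) (row d3 Q) (row d1 Q))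
  + obstruction (chart_remainder r) 0.
Proof.
move=> hW Rr; rewrite -(obstruction_weyl Q hW) -/weyl_part.
rewrite /obstruction !(sphere_metric_jet _ _ _ Rr) !round_jet3.
by ring.
Qed.

Hypothesis embeddable : forall r0, exists2 r, r0 < r & sphere_locally_embeddable g r.

Lemma weyl_frame_component0 : algebraic_weyl W ->
  quad W (row d0 Q) (row d2 Q) (row d3 Q) (row d1 Q) = 0.
Proof.
move=> hW; apply/eqP; apply: contrapT => /negP q0.
set q := quad W _ _ _ _ in q0.
have qn : 0 < `|q| by rewrite normr_gt0.
have [C0 [r0 [C0_ge0 H0]]] := sphere_metric_jets_close 0.
have [C1 [r1 [C1_ge0 H1]]] := sphere_metric_jets_close 1.
have [C2 [r2 [C2_ge0 H2]]] := sphere_metric_jets_close 2.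
have [C3 [r3 [C3_ge0 H3]]] := sphere_metric_jets_close 3.
have [D [rD [D_ge0 HD]]] := obstruction_remainder_decay.
(* One constant for the derivatives of order 0 to 3; the summand 1 makes it positive, as does the
   one in [1 + D], so that both can be divided by. *)
pose C := 1 + C0 + C1 + C2 + C3.
have C_gt0 : 0 < C by rewrite /C; lra.
have [C0C C1C C2C C3C] : [/\ C0 <= C, C1 <= C, C2 <= C & C3 <= C].
  by split; rewrite /C; lra.
have norm24 : `|- 24| = 24 :> R by rewrite normrN ger0_norm.
have two_gt0 : 0 < 2 :> R by [].
have k1_gt0 : 0 < 1000 * 1000 :> R by lra.
have k2_gt0 : 0 < 2400 * 1000 :> R by lra.
have D1_gt0 : 0 < 1 + D by lra.
have e1_gt0 : 0 < (1000 * 1000 * C)^-1 by rewrite invr_gt0 (mulr_gt0 k1_gt0 C_gt0).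
have kCC_gt0 := mulr_gt0 k2_gt0 (mulr_gt0 C_gt0 C_gt0).
have e2_gt0 := divr_gt0 qn kCC_gt0.
have e3_gt0 := divr_gt0 qn D1_gt0.
(* Beyond [ra] the metric is close enough to the round one for the quadratic estimate; beyond [rb]
   that estimate, and beyond [rc] the remainder, is at most |q| r^-2. *)
have [ra Ha] := powR_decay two_gt0 e1_gt0.
have [rb Hb] := powR_decay two_gt0 e2_gt0.
have [rc Hc] := powR_decay eps_gt0 e3_gt0.
have [r] := embeddable (Num.max R0 (Num.max (Num.max r0 r1) (Num.max (Num.max r2 r3)
  (Num.max rD (Num.max ra (Num.max rb rc)))))).
rewrite !gt_max => /and3P[Rr /andP[rr0 rr1] /and3P[/andP[rr2 rr3] rrD /and3P[rra rrb rrc]]].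
have r_gt0 : 0 < r := lt_trans R0_gt0 Rr.
pose delta := r ^- 2.
have delta_gt0 : 0 < delta by rewrite invr_gt0 exprn_gt0.
have deltaE : r `^ (- 2) = delta by rewrite (powRN r 2) powR_mulrn // ltW.
have Cdelta : C * delta <= (1000 * 1000)^-1.
  have := Ha r rra; rewrite deltaE => /ltW /(ler_wpM2l (ltW C_gt0)) h.
  by apply: le_trans h _; rewrite invfM mulrCA (divff (lt0r_neq0 C_gt0)) mulr1.
have CCdelta : 2400 * 1000 * (C * C) * delta <= `|q|.
  by have := Hb r rrb; rewrite deltaE (ltr_pdivlMr _ _ kCC_gt0) mulrC => /ltW.
have Ddelta : D * r `^ (- eps) <= `|q|.
  have := Hc r rrc; rewrite (ltr_pdivlMr _ _ D1_gt0) mulrC => /ltW; apply: le_trans.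
  by rewrite ler_wpM2r ?powR_ge0 // lerDr.
move=> emb; have B0 := @chart_ball0 R.
have [|V [F [[oV V0] sF _ iso]]] := emb (r *: sphere_chart Q 0).
  by rewrite /coord_sphere /= enormZ_unit ?sphere_chart_unit // ltW.
have isoV x X Y : V x -> enorm x = r -> dot X x = 0 -> dot Y x = 0 ->
  dot ('D_X F x) ('D_Y F x) = inner g x X Y by move=> Vx xr; apply: iso; split.
have sm i j := smooth_sphere_metric i j Rr.
have C_le (c : R) : c <= C -> c * delta <= C * delta by move=> cC; rewrite ler_wpM2r // ltW.
have small : `|obstruction (sphere_metric Q g r) 0| <= 2400 * 1000 * (C * delta * (C * delta)).
  apply: (embedded_obstruction QQ r_gt0 oV sF isoV sm V0 Cdelta).
  - move=> i j; have := H0 r rr0 [::] i j (erefl _); rewrite round_jet0 dpd.unlock /= => h.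
    by apply: le_trans h (C_le C0 C0C).
  - move=> k i j; have := H1 r rr1 [:: k] i j (erefl _); rewrite round_jet1 subr0 => h.
    by apply: le_trans h (C_le C1 C1C).
  - move=> l k i j; have := H2 r rr2 [:: l; k] i j (erefl _); rewrite round_jet2 => h.
    rewrite rmorphD !rmorphM /= in h.
    by apply: le_trans h (C_le C2 C2C).
  - move=> m l k i j; have := H3 r rr3 [:: m; l; k] i j (erefl _).
    rewrite round_jet3 subr0 => h.
    by apply: le_trans h (C_le C3 C3C).
have := HD r rrD; rewrite (powR_split r_gt0) -/delta => rem.
move: small; rewrite (obstruction_sphere_metric hW Rr) -/delta -/q => small.
have qdelta : 0 < `|q| * delta by rewrite mulr_gt0.
have small' : 2400 * 1000 * (C * delta * (C * delta)) <= `|q| * delta.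
  have -> : 2400 * 1000 * (C * delta * (C * delta)) = 2400 * 1000 * (C * C) * delta * delta.
    by ring.
  by rewrite ler_wpM2r // ltW.
have rem' : `|obstruction (chart_remainder r) 0| <= `|q| * delta.
  by apply: le_trans rem _; rewrite mulrCA mulrC ler_wpM2r // ltW.
(* The left side is 24 |q| delta with |q| delta positive, which is the contradiction. *)
have : `|delta * (- 24 * q)| <= 2 * (`|q| * delta).
  have -> : delta * (- 24 * q) = delta * (- 24 * q) + obstruction (chart_remainder r) 0
    - obstruction (chart_remainder r) 0 by ring.
  by apply: le_trans (ler_normB _ _) _; rewrite (_ : 2 = 1 + 1) // mulrDl mul1r; apply: lerD => //; exact: le_trans small small'.
rewrite normrM (ger0_norm (ltW delta_gt0)) normrM norm24 mulrCA (mulrC delta).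
by rewrite ler_pM2r // leNgt ltr_nat.
Qed.

End Expansion.

Theorem proposition2p1 (R : realType) (M : riemannian4 R) (a : mfd_index M)
  (R0 eps : R) (W : tensor4 R) (Xi : R -> tensor4 R)
  (hflat : scalar_flat M)
  (hR0 : 0 < R0)
  (hend : chart_img (mfd_chart a) = [set x | R0 < enorm x])
  (heps : 0 < eps < 1)
  (hW : algebraic_weyl W)
  (hXi : mass_tensor Xi)
  (hasym : forall i j : 'I_4,
     bigO_oo (2 + eps) (fun x : E4 R =>
       mfd_metric a x i j - (i == j)%:R -
       \sum_k \sum_l
         (W i k l j + Xi (9 * m_adm (mfd_metric a)) i j k l) *
         (x 0 k * x 0 l / enorm x ^+ 4)))
  (hW0 : exists i j k l, W i j k l != 0) :
  exists r0 : R, forall r : R, r0 < r ->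
    ~ sphere_locally_embeddable (mfd_metric a) r.
Proof.
apply: contrapT => not_eventually.
have embeddable r0 : exists2 r, r0 < r & sphere_locally_embeddable (mfd_metric a) r.
  apply: contrapT => none; apply: not_eventually; exists r0 => r r0r emb.
  by apply: none; exists r.
have /andP[eps_gt0 _] := heps.
have sg i j : smooth_on [set x | R0 < enorm x] (fun x => mfd_metric a x i j : R^o).
  by rewrite -hend; have [] := mfd_riemannian a.
have [i [j [k [l]]]] := hW0; rewrite (weyl_vanishing hW _ i j k l) ?eqxx // => Q QQ.
exact: (weyl_frame_component0 QQ hR0 eps_gt0 sg hXi hasym embeddable hW).
Qed.
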